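(* Let $(M,g)$ be an $n$-dimensional spacetime, $n\geq 3$, let $h$ be a positive smooth function on $M$ which is not constant on any nonempty open subset, and let $\Lambda\in\mathbb{R}$. Suppose that $(M,g,h\,dvol_g)$ is an isotropic solution of the vacuum weighted Einstein field equation, i.e. $h\rho-\operatorname{Hes}_h+(\Delta h+\Lambda)g=0$ and $\nabla h$ is lightlike. Then one of the following possibilities holds: (1) $(M,g)$ is Ricci-flat and $\operatorname{Hes}_h=0$. (2) The Ricci operator is $2$-step nilpotent and $(M,g)$ is a Brinkmann wave. (3) The Ricci operator is $3$-step nilpotent and $(M,g)$ is a Kundt spacetime.
   Context: A spacetime is a connected smooth Lorentzian manifold. $\rho$ is the Ricci tensor, $\operatorname{Ric}$ the Ricci operator ($\rho(X,Y)=g(\operatorname{Ric}X,Y)$), $\nabla h$ the gradient of $h$, $\operatorname{Hes}_h(X,Y)=g(\nabla_X\nabla h,Y)$ the Hessian, and $\Delta h=\operatorname{tr}_g\operatorname{Hes}_h$. A vector field $V$ is lightlike if $V\neq 0$ at every point and $g(V,V)=0$. The field of operators $\operatorname{Ric}$ is $k$-step nilpotent if $\operatorname{Ric}^k=0$ and $\operatorname{Ric}^{k-1}$ is not identically zero. A Brinkmann wave is a spacetime admitting a parallel lightlike line field, i.e. a lightlike recurrent vector field $V$: $\nabla_XV=\omega(X)V$ for all $X$, for some $1$-form $\omega$. For a lightlike vector field $V$ the optical scalars of expansion, shear and twist are $\theta=\frac{1}{n-2}\nabla_iV^i$, $\sigma^2=(\nabla^iV^j)\nabla_{(i}V_{j)}-(n-2)\theta^2$,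 $\omega^2=(\nabla^iV^j)\nabla_{[i}V_{j]}$, where parentheses and brackets on indices denote symmetrization and anti-symmetrization. A Kundt spacetime is a spacetime admitting a lightlike geodesic vector field $V$ ($\nabla_VV=0$) with $\theta=\sigma^2=\omega^2=0$. *)

(* Defs.v *)
(* Pseudo-Riemannian geometry in local coordinates.

   The point values of tensor fields are represented classically: by one array
   of components for each chart, subject to the tensorial transformation law on
   overlaps.  Component functions are defined on the whole carrier and are
   meaningful only on the domain of the chart they refer to.  Tangent vectors
   are row vectors, so an operator A acts by X |-> X *m A and
   g(X, Y) = X *m G *m Y^T. *)

From mathcomp Require Import all_boot all_order all_algebra.
From mathcomp Require Import all_classical all_reals all_analysis.

Set Implicit Arguments.
Unset Strict Implicit.
Unset Printing Implicit Defensive.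

Import Order.TTheory GRing.Theory Num.Theory.
Import numFieldNormedType.Exports.

Local Open Scope classical_set_scope.
Local Open Scope ring_scope.

Section Smoothness.
Variables (R : realType) (n : nat).
Implicit Types (U : set 'rV[R]_n) (f : 'rV[R]_n -> R).

(* Meant for open U. *)
Fixpoint is_Ck (k : nat) U f : Prop :=
  (forall x, U x -> {for x, continuous f}) /\
  if k is k'.+1 then
    forall i : 'I_n,
      (forall x, U x -> derivable f x (delta_mx 0 i)) /\
      is_Ck k' U (fun x => 'D_(delta_mx 0 i) f x)
  else True.

Definition is_smooth U f : Prop := forall k, is_Ck k U f.

End Smoothness.

(* The values of cphi off cdom and of cpsi off cphi @` cdom are irrelevant. *)
Record chart (R : realType) (n : nat) (T : topologicalType) := Chart {
  cdom : set T;
  cphi : T -> 'rV[R]_n;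
  cpsi : 'rV[R]_n -> T;
  cdom_open : open cdom;
  cimg_open : open (cphi @` cdom);
  cphiK : forall p, cdom p -> cpsi (cphi p) = p;
  cphi_continuous : forall p, cdom p -> {for p, continuous cphi};
  cpsi_continuous : forall x, (cphi @` cdom) x -> {for x, continuous cpsi}
}.

(* The smooth structure is given by an atlas, which need not be maximal. *)
Record manifold (R : realType) (n : nat) := Manifold {
  carrier :> topologicalType;
  mhausdorff : hausdorff_space carrier;
  msecond_countable : @second_countable carrier;
  cindex : Type;
  atlas : cindex -> chart R n carrier;
  atlas_cover : forall p, exists a, cdom (atlas a) p;
  atlas_compatible : forall a b (j : 'I_n),
    is_smooth (cphi (atlas a) @` (cdom (atlas a) `&` cdom (atlas b)))
      (fun x => cphi (atlas b) (cpsi (atlas a) x) 0 j)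
}.

Section Fields.
Variables (R : realType) (n : nat) (M : manifold R n).
Implicit Types (a b : cindex M) (p q : M) (f : M -> R).

Definition dom a : set M := cdom (atlas a).

Definition smooth_in_chart a f : Prop :=
  is_smooth (cphi (atlas a) @` dom a) (f \o cpsi (atlas a)).

Definition smooth_fun f : Prop := forall a, smooth_in_chart a f.

(* (d f / d x^i)(p), where x^1, ..., x^n are the coordinates of the chart a. *)
Definition pd a (i : 'I_n) f p : R :=
  'D_(delta_mx 0 i) (f \o cpsi (atlas a)) (cphi (atlas a) p).

(* (d y^j / d x^i)(p), where x and y are the coordinates of a and b. *)
Definition jac a b p : 'M[R]_n :=
  \matrix_(i, j) pd a i (fun q => cphi (atlas b) q 0 j) p.

Definition vector_field (V : cindex M -> M -> 'rV[R]_n) : Prop :=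
  (forall a i, smooth_in_chart a (fun p => V a p 0 i)) /\
  (forall a b p, dom a p -> dom b p -> V b p = V a p *m jac a b p).

Definition one_form (w : cindex M -> M -> 'rV[R]_n) : Prop :=
  (forall a i, smooth_in_chart a (fun p => w a p 0 i)) /\
  (forall a b p, dom a p -> dom b p -> w a p = w b p *m (jac a b p)^T).

Definition bilinear_form_field (B : cindex M -> M -> 'M[R]_n) : Prop :=
  (forall a i j, smooth_in_chart a (fun p => B a p i j)) /\
  (forall a b p, dom a p -> dom b p ->
     B a p = jac a b p *m B b p *m (jac a b p)^T).

End Fields.

Definition minkowski (R : realType) (n : nat) : 'M[R]_n :=
  \matrix_(i, j) if i == j then (if nat_of_ord i == 0%N then -1 else 1) else 0.

(* G is symmetric of signature (-, +, ..., +): it has a pseudo-orthonormal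
   basis, the rows of P. *)
Definition lorentzian_form (R : realType) (n : nat) (G : 'M[R]_n) : Prop :=
  G^T = G /\
  exists2 P : 'M[R]_n, P \in unitmx & P *m G *m P^T = minkowski R n.

Record spacetime (R : realType) (n : nat) := Spacetime {
  smanifold :> manifold R n;
  sconnected : connected [set: smanifold];
  metric : cindex smanifold -> smanifold -> 'M[R]_n;
  metric_field : bilinear_form_field metric;
  metric_lorentzian : forall a p, dom a p -> lorentzian_form (metric a p)
}.

Section Geometry.
Variables (R : realType) (n : nat) (M : spacetime R n).
Implicit Types (a : cindex M) (p : M) (h : M -> R).
Implicit Types (V w : cindex M -> M -> 'rV[R]_n).

Definition inv_metric a p : 'M[R]_n := invmx (metric a p).

(* Gamma^k_ij *)
Definition christoffel a (k i j : 'I_n) p : R :=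
  2^-1 * \sum_(l < n) inv_metric a p k l *
    (pd a i (fun q => metric a q j l) p + pd a j (fun q => metric a q i l) p
     - pd a l (fun q => metric a q i j) p).

(* The d_l-component of R(d_i, d_j) d_k, where
   R(X, Y) = [nabla_X, nabla_Y] - nabla_[X, Y]. *)
Definition curvature a (i j k l : 'I_n) p : R :=
  pd a i (christoffel a l j k) p - pd a j (christoffel a l i k) p
  + \sum_(m < n) (christoffel a l i m p * christoffel a m j k p
                  - christoffel a l j m p * christoffel a m i k p).

(* rho(Y, Z) = trace of X |-> R(X, Y) Z *)
Definition ricci_tensor a p : 'M[R]_n :=
  \matrix_(j, k) \sum_(i < n) curvature a i j k i p.

(* rho(X, Y) = g(Ric X, Y) *)
Definition ricci_operator a p : 'M[R]_n := ricci_tensor a p *m inv_metric a p.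

(* The (i, k) entry is nabla_i V^k, so X *m nabla V a p represents nabla_X V. *)
Definition nabla V a p : 'M[R]_n :=
  \matrix_(i, k) (pd a i (fun q => V a q 0 k) p
                  + \sum_(l < n) christoffel a k i l p * V a p 0 l).

Definition grad h a p : 'rV[R]_n :=
  (\row_i pd a i h p) *m inv_metric a p.

(* Hes_h(X, Y) = g(nabla_X (grad h), Y) *)
Definition hessian h a p : 'M[R]_n := nabla (grad h) a p *m metric a p.

Definition laplacian h a p : R := \tr (inv_metric a p *m hessian h a p).

Definition lightlike V : Prop :=
  forall a p, dom a p -> V a p != 0 /\ V a p *m metric a p *m (V a p)^T = 0.

Definition vacuum_weighted_einstein h (Lambda : R) : Prop :=
  forall a p, dom a p ->
    h p *: ricci_tensor a p - hessian h a p
    + (laplacian h a p + Lambda) *: metric a p = 0.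

Definition ricci_flat : Prop := forall a p, dom a p -> ricci_tensor a p = 0.

Definition ricci_step_nilpotent (k : nat) : Prop :=
  (forall a p, dom a p -> ricci_operator a p ^+ k = 0) /\
  (exists a p, dom a p /\ ricci_operator a p ^+ k.-1 != 0).

Definition recurrent V : Prop :=
  exists2 w, one_form w &
    forall a p (X : 'rV[R]_n), dom a p ->
      X *m nabla V a p = (\sum_(i < n) w a p 0 i * X 0 i) *: V a p.

Definition brinkmann_wave : Prop :=
  exists V, [/\ vector_field V, lightlike V & recurrent V].

(* nabla_i V_j and nabla^i V^j *)
Definition nabla_low V a p : 'M[R]_n := nabla V a p *m metric a p.
Definition nabla_up V a p : 'M[R]_n := inv_metric a p *m nabla V a p.

Definition expansion V a p : R := (n%:R - 2)^-1 * \sum_(i < n) nabla V a p i i.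

Definition shear_sq V a p : R :=
  \sum_(i < n) \sum_(j < n) nabla_up V a p i j *
    (2^-1 * (nabla_low V a p i j + nabla_low V a p j i))
  - (n%:R - 2) * expansion V a p ^+ 2.

Definition twist_sq V a p : R :=
  \sum_(i < n) \sum_(j < n) nabla_up V a p i j *
    (2^-1 * (nabla_low V a p i j - nabla_low V a p j i)).

Definition geodesic_field V : Prop :=
  forall a p, dom a p -> V a p *m nabla V a p = 0.

Definition kundt_spacetime : Prop :=
  exists V, [/\ vector_field V, lightlike V, geodesic_field V &
    forall a p, dom a p ->
      [/\ expansion V a p = 0, shear_sq V a p = 0 & twist_sq V a p = 0]].

End Geometry.

(* Main.v *)
From HB Require Import structures.
Require Import Defs.
From mathcomp Require Import all_boot all_order all_algebra.
From mathcomp Require Import all_classical all_reals all_analysis.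
From mathcomp Require Import ring lra.
Import Order.TTheory GRing.Theory Num.Theory.
Import numFieldNormedType.Exports.
Local Open Scope classical_set_scope.
Local Open Scope ring_scope.

(** Write V for the gradient of h, A for the operator X |-> nabla_X V, r for the
    Ricci operator and tau for its trace.  Raising an index in the field
    equation gives h r - A + (tr A + Lambda) 1 = 0, because the Laplacian of h
    is tr A.

    Taking the divergence of this equation, the term Ric V coming from the
    derivative of h cancels against the one in the Ricci identity
    div A = d (tr A) + Ric V ([ricci_identity]), the derivatives of tr A cancel
    too, and what is left is h div r = 0.  The contracted Bianchi identity
    2 div r = d tau ([contracted_bianchi]) then makes tau locally constant
    ([scalar_curvature_critical]).

    Since g(V, V) = 0, differentiation gives g(A X, V) = 0 for all X, and A is
    self-adjoint, so V is geodesic and A V = 0.  Contracting the Ricci identity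
    with V yields the Raychaudhuri equation V(tr A) = - tr A^2 - Ric(V, V)
    ([raychaudhuri]).  Both other terms vanish: Ric(V, V) by the field equation,
    and V(tr A) because by the trace of the field equation d (tr A) is a
    multiple of dh.  Hence tr A^2 = 0 ([trace_sq_eq0]).

    A self-adjoint A with A V = 0 acts on the quotient of the orthogonal of V by
    V, which is Euclidean, and tr A^2 is the square of the Hilbert-Schmidt norm
    of that action.  So the action is zero, which means that
    g(A X, Y) = l(X) al(Y) + al(X) l(Y) with l = g(V, -) and al(V) = 0
    ([null_operator_form]).  From this form tr A = 0 and A^3 = 0, and if A^2 = 0
    then A X = f l(X) V for a scalar f.

    With tr A = 0 the trace of the field equation reads h tau = - n Lambda.  As
    tau is critical and dh has no zero, tau = 0 and Lambda = 0, hence A = h r.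
    The three cases are then r = 0; r <> 0 with r^2 = 0 everywhere; and r^2 not
    identically 0.  In the second one V is recurrent, and its one-form is smooth
    because V has no zero; that it is a tensor rests on the transformation law
    of the Hessian ([hessian_change]).  In the third one V is a Kundt field: its
    expansion is a multiple of tr A, its shear is tr A^2 and its twist vanishes
    because A is self-adjoint.

    Everything is computed in the coordinates of one chart, with matrices:
    nabla_i W = d_i W + W Gam_i for a row vector W, where Gam_i is [conn i].
    The analysis needed is the symmetry of second derivatives and the chain
    rule, both for functions whose smoothness is expressed by iterated partial
    derivatives. *)

Set Implicit Arguments.
Unset Strict Implicit.
Unset Printing Implicit Defensive.

(** * Algebra of functions of class C^k *)

Section SmoothAlgebra.
Variables (R : realType) (n : nat).
Implicit Types (U : set 'rV[R]_n) (f g : 'rV[R]_n -> R).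

Lemma near_open_eq U f g x : open U -> U x -> (forall y, U y -> f y = g y) ->
  \forall y \near x, f y = g y.
Proof.
by move=> oU Ux fg; have := open_nbhs_nbhs (conj oU Ux); apply: filterS.
Qed.

Lemma is_Ck_ext U f g k : open U -> (forall y, U y -> f y = g y) ->
  is_Ck k U f -> is_Ck k U g.
Proof.
move=> oU; elim: k f g => [|k IH] f g fg.
  move=> [fc _]; split => // x Ux.
  have nfg := near_open_eq oU Ux fg.
  suff: g @ x --> g x by []; rewrite -(fg x Ux).
  exact: cvg_trans (near_eq_cvg nfg) (fc x Ux).
move=> [fc fd]; split.
  move=> x Ux; have nfg := near_open_eq oU Ux fg.
  suff: g @ x --> g x by []; rewrite -(fg x Ux).
  exact: cvg_trans (near_eq_cvg nfg) (fc x Ux).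
move=> i; have [fi fk] := fd i; split.
  move=> x Ux; apply: near_eq_derivable (fi x Ux); exact: near_open_eq oU Ux fg.
apply: IH fk => y Uy; apply: near_eq_derive; exact: near_open_eq oU Uy fg.
Qed.

Lemma is_Ck_continuous k U f x : is_Ck k U f -> U x -> {for x, continuous f}.
Proof. by case: k => [|k] [fc _]; exact: fc. Qed.

Lemma is_CkS k U f : is_Ck k.+1 U f -> is_Ck k U f.
Proof.
elim: k f => [|k IH] f [fc fd]; first by split.
by split => // i; have [fi fk] := fd i; split => //; exact: IH.
Qed.

Lemma is_Ck_cst k U (c : R) : open U -> is_Ck k U (cst c).
Proof.
move=> oU; elim: k c => [|k IH] c; split => //; try by move=> x _; exact: cst_continuous.
move=> i; split; first by move=> x _; exact: derivable_cst.
by apply: is_Ck_ext (IH 0) => // y Uy; rewrite derive_cst.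
Qed.

Lemma is_CkD k U f g : open U -> is_Ck k U f -> is_Ck k U g ->
  is_Ck k U (fun x => f x + g x).
Proof.
move=> oU; elim: k f g => [|k IH] f g [fc fd] [gc gd].
  by split => // x Ux; apply: continuousD; [exact: fc|exact: gc].
split; first by move=> x Ux; apply: continuousD; [exact: fc|exact: gc].
move=> i; have [fi fk] := fd i; have [gi gk] := gd i; split.
  by move=> x Ux; apply: derivableD; [exact: fi|exact: gi].
apply: is_Ck_ext (IH _ _ fk gk) => // y Uy.
by rewrite -[RHS]/(derive (f + g) y _) deriveD //; [exact: fi|exact: gi].
Qed.

Lemma is_CkM k U f g : open U -> is_Ck k U f -> is_Ck k U g ->
  is_Ck k U (fun x => f x * g x).
Proof.
move=> oU; elim: k f g => [|k IH] f g fC gC.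
  split => // x Ux; apply: continuousM;
    [exact: is_Ck_continuous fC Ux|exact: is_Ck_continuous gC Ux].
have [fc fd] := fC; have [gc gd] := gC.
split; first by move=> x Ux; apply: continuousM;
    [exact: is_Ck_continuous fC Ux|exact: is_Ck_continuous gC Ux].
move=> i; have [fi fk] := fd i; have [gi gk] := gd i; split.
  by move=> x Ux; apply: derivableM; [exact: fi|exact: gi].
apply: is_Ck_ext (is_CkD oU (IH _ _ (is_CkS fC) gk) (IH _ _ (is_CkS gC) fk)) => // y Uy.
by rewrite -[RHS]/(derive (f * g) y _) deriveM //; [exact: fi|exact: gi].
Qed.

Lemma is_CkV k U f : open U -> (forall x, U x -> f x != 0) -> is_Ck k U f ->
  is_Ck k U (fun x => (f x)^-1).
Proof.
move=> oU f0; elim: k => [|k IH] fC.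
  split => // x Ux; apply: continuousV; [exact: f0|exact: is_Ck_continuous fC Ux].
have [fc fd] := fC.
split.
  by move=> x Ux; apply: continuousV; [exact: f0|exact: is_Ck_continuous fC Ux].
move=> i; have [fi fk] := fd i; split.
  by move=> x Ux; apply: derivableV; [exact: f0|exact: fi].
have iC := IH (is_CkS fC).
apply: is_Ck_ext (is_CkM oU (is_Ck_cst k (-1) oU) (is_CkM oU (is_CkM oU iC iC) fk)) => // y Uy.
rewrite deriveV; [|exact: f0|exact: fi].
by rewrite /cst /= mulN1r -exprVn expr2 scaleNr.
Qed.

End SmoothAlgebra.

(** * Mean values and the symmetry of second derivatives *)

Section MeanValue.
Variables (R : realType) (V : normedModType R).
Implicit Types (f : V -> R) (x v : V).

(** Reduces statements on directional derivatives to functions of one real variable. *)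
Lemma is_derive_line f x v (s : R) : derivable f (x + s *: v) v ->
  is_derive s 1 (fun t : R => f (x + t *: v)) ('D_v f (x + s *: v)).
Proof.
move=> df.
have E : (fun h : R => h^-1 *: (((fun t : R => f (x + t *: v)) \o shift s) (h *: 1) -
   f (x + s *: v))) = (fun h : R => h^-1 *: ((f \o shift (x + s *: v)) (h *: v) - f (x + s *: v))).
  apply/funext => h /=; congr (_ *: (f _ - _)).
  by rewrite [h *: 1]mulr1 scalerDl addrCA.
by split; rewrite /derivable /derive E.
Qed.

Lemma mean_value_line f x v (t : R) :
  (forall s : R, `|s| <= `|t| -> derivable f (x + s *: v) v) ->
  exists2 s : R, `|s| <= `|t| & f (x + t *: v) - f x = t * 'D_v f (x + s *: v).
Proof.
move=> df.
pose g (s : R) := f (x + s *: v).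
have dg (s : R) : `|s| <= `|t| -> is_derive s 1 g ('D_v f (x + s *: v)).
  by move=> /df; exact: is_derive_line.
have gc a b : (forall s, s \in `[a, b]%R -> `|s| <= `|t|) -> {within `[a, b], continuous g}.
  move=> ab; apply: derivable_within_continuous => s /ab /dg H.
  exact: ex_derive.
have g0 : g 0 = f x by rewrite /g scale0r addr0.
have [t0|t0] := leP 0 t.
  have ab s : s \in `[0, t]%R -> `|s| <= `|t|.
    by rewrite in_itv /= => /andP[s0 st]; rewrite !ger0_norm.
  have [|c cab E] := MVT_segment (f := g) (df := fun s => 'D_v f (x + s *: v)) t0 _ (gc _ _ ab).
    by move=> s; rewrite in_itv /= => /andP[s0 st]; apply/dg/ab; rewrite in_itv /= !ltW.
  exists c; first exact: ab.
  by rewrite -g0 -[f (x + _)]/(g t) E subr0 mulrC.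
have ab s : s \in `[t, 0]%R -> `|s| <= `|t|.
  rewrite in_itv /= => /andP[s0 st]; rewrite ler0_norm// ltr0_norm//.
  by rewrite lerN2.
have [|c cab E] := MVT_segment (f := g) (df := fun s => 'D_v f (x + s *: v)) (ltW t0) _ (gc _ _ ab).
  by move=> s; rewrite in_itv /= => /andP[s0 st]; apply/dg/ab; rewrite in_itv /= !ltW.
exists c; first exact: ab.
rewrite -g0 -[f (x + _)]/(g t) -opprB E; ring.
Qed.
End MeanValue.

Section Partials.
Variables (R : realType) (n : nat).
Implicit Types (f : 'rV[R]_n -> R) (x : 'rV[R]_n).
Local Notation e i := (delta_mx 0 i : 'rV[R]_n).

Lemma norm_rV_le (u : 'rV[R]_n) (d : R) : 0 <= d -> (forall j, `|u 0 j| <= d) -> `|u| <= d.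
Proof.
move=> d0 ud; rewrite [leLHS]/Num.Def.normr/= mx_normrE; apply: bigmax_le => // -[i j] _.
by rewrite ord1; exact: ud.
Qed.

Lemma norm_rV_ge (u : 'rV[R]_n) j : `|u 0 j| <= `|u|.
Proof.
rewrite [leRHS]/Num.Def.normr/= mx_normrE.
exact: (le_bigmax _ (fun ij : 'I_1 * 'I_n => `|u ij.1 ij.2|) (0, j)).
Qed.

Lemma dist_le_halves (a b c eps : R) :
  `|a - c| < eps / 2 -> `|b - c| < eps / 2 -> `|a - b| <= eps.
Proof.
move=> ac bc; rewrite (splitr eps) -(subrKA c).
apply: (le_trans (ler_normD _ _)); apply: lerD; first exact: ltW.
by rewrite distrC ltW.
Qed.

(** The second difference is the increment along e_i of the first difference
    f (. + t e_j) - f, so two mean values express it by a mixed derivative.  The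
    left-hand side is symmetric in (s, i) and (t, j); [schwarz] uses it both
    ways. *)
Lemma schwarz_mean_value f x i j (r s t : R) :
  (forall y, `|y - x| < r -> derivable f y (e i) /\ derivable ('D_(e i) f) y (e j)) ->
  `|s| + `|t| < r ->
  exists2 y, `|y - x| <= `|s| + `|t| &
    f (x + s *: e i + t *: e j) - f (x + s *: e i) - (f (x + t *: e j) - f x)
    = s * t * 'D_(e j) ('D_(e i) f) y.
Proof.
have ne k : `|e k| <= 1.
  apply: norm_rV_le => // l; rewrite mxE eqxx /=.
  by case: (_ == _); rewrite ?normr1 ?normr0.
have nse (a : R) k : `|a *: e k| <= `|a| by rewrite normrZ ler_piMr.
move=> df st.
have near_x a b : `|a| <= `|s| -> `|b| <= `|t| -> `|x + a *: e i + b *: e j - x| <= `|s| + `|t|.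
  move=> a1 b1; rewrite -(addrA x) addrAC subrr add0r.
  apply: (le_trans (ler_normD _ _)); apply: lerD.
    exact: le_trans (nse _ _) _.
  exact: le_trans (nse _ _) _.
pose F y := f (y + t *: e j) - f y.
have t0 : `|0 : R| <= `|t| by rewrite normr0.
have dF a : `|a| <= `|s| -> is_derive (x + a *: e i) (e i) F
   ('D_(e i) f (x + a *: e i + t *: e j) - 'D_(e i) f (x + a *: e i)).
  move=> a1; apply: is_deriveB; last first.
    apply: derivableP; have := near_x a 0 a1 t0; rewrite scale0r addr0 => H.
    by have [] := df _ (le_lt_trans H st).
  have [H _] := df _ (le_lt_trans (near_x a t a1 (lexx _)) st).
  split; move: (H); rewrite /derivable /derive /=.
    by under eq_fun do rewrite addrA.
  by move=> _; under eq_fun do rewrite -addrA.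
have [|a a1 E1] := @mean_value_line R _ F x (e i) s.
  by move=> a /dF [].
rewrite -/(F (x + s *: e i)) -/(F x) E1.
have := dF a a1 => -[_ ->].
have [|b b1 E2] := @mean_value_line R _ ('D_(e i) f) (x + a *: e i) (e j) t.
  by move=> b b1; have [] := df _ (le_lt_trans (near_x a b a1 b1) st).
by exists (x + a *: e i + b *: e j); [exact: near_x|rewrite E2 mulrA].
Qed.

(** With s = t = d the two expressions of the second difference give equal mixed
    derivatives at two points within 2 d of x; continuity brings both to x. *)
Lemma schwarz f x i j r : 0 < r ->
  (forall y, `|y - x| < r ->
     [/\ derivable f y (e i), derivable f y (e j), derivable ('D_(e i) f) y (e j)
       & derivable ('D_(e j) f) y (e i)]) ->
  {for x, continuous ('D_(e j) ('D_(e i) f))} ->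
  {for x, continuous ('D_(e i) ('D_(e j) f))} ->
  'D_(e j) ('D_(e i) f) x = 'D_(e i) ('D_(e j) f) x.
Proof.
move=> r0 df c1 c2.
apply/eqP; rewrite -subr_eq0 -normr_le0; apply/ler_addgt0Pr => eps eps0; rewrite add0r.
have e2 : 0 < eps / 2 by lra.
have /cvgrPdist_lt /(_ _ e2) /nbhs_ballP [d1 /= d10 H1] := c1.
have /cvgrPdist_lt /(_ _ e2) /nbhs_ballP [d2 /= d20 H2] := c2.
pose d := Num.min r (Num.min d1 d2) / 4.
have dpos : 0 < d by rewrite divr_gt0 // !lt_min r0 d10 d20.
have ltd m : Num.min r (Num.min d1 d2) <= m -> d + d < m.
  move=> /lt_le_trans; apply.
  have m0 : 0 < Num.min r (Num.min d1 d2) by rewrite !lt_min r0 d10 d20.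
  rewrite /d; move: (Num.min _ _) m0 => m' m0.
  clear -m0; lra.
have dr : d + d < r by apply: ltd; rewrite ge_min lexx.
have dd1 : d + d < d1 by apply: ltd; rewrite !ge_min lexx orbT.
have dd2 : d + d < d2 by apply: ltd; rewrite !ge_min lexx !orbT.
have nd : `|d| = d by rewrite gtr0_norm.
clearbody d; have nr : `|d| + `|d| < r by rewrite nd.
have [y1 y1x E1] : exists2 y, `|y - x| <= d + d &
    f (x + d *: e i + d *: e j) - f (x + d *: e i) - (f (x + d *: e j) - f x)
    = d * d * 'D_(e j) ('D_(e i) f) y.
  by rewrite -{1 2}nd; apply: schwarz_mean_value nr => y /df [].
have [y2 y2x E2] : exists2 y, `|y - x| <= d + d &
    f (x + d *: e j + d *: e i) - f (x + d *: e j) - (f (x + d *: e i) - f x)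
    = d * d * 'D_(e i) ('D_(e j) f) y.
  by rewrite -{1 2}nd; apply: schwarz_mean_value nr => y /df [].
have E : 'D_(e j) ('D_(e i) f) y1 = 'D_(e i) ('D_(e j) f) y2.
  move: E1 E2; rewrite (addrAC x).
  move: (f (_ + _ + _)) (f (x + d *: e i)) (f (x + d *: e j)) (f x)
    ('D_(e j) _ y1) ('D_(e i) _ y2) => A B C D u w E1 E2.
  by apply: (mulfI (mulf_neq0 (lt0r_neq0 dpos) (lt0r_neq0 dpos))); rewrite -E1 -E2; ring.
have {}H1 : `|'D_(e j) ('D_(e i) f) x - 'D_(e i) ('D_(e j) f) y2| < eps / 2.
  rewrite -E; apply: H1; rewrite -ball_normE /= distrC; exact: le_lt_trans dd1.
have {}H2 : `|'D_(e i) ('D_(e j) f) x - 'D_(e i) ('D_(e j) f) y2| < eps / 2.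
  apply: H2; rewrite -ball_normE /= distrC; exact: le_lt_trans dd2.
exact: dist_le_halves H1 H2.
Qed.

Lemma is_Ck_schwarz U f x i j : open U -> U x -> is_Ck 2 U f ->
  'D_(e j) ('D_(e i) f) x = 'D_(e i) ('D_(e j) f) x.
Proof.
move=> oU Ux [fc fd].
have := open_nbhs_nbhs (conj oU Ux) => /nbhs_ballP [r /= r0 rU].
have [fi [_ gi]] := fd i; have [fj [_ gj]] := fd j.
have [dij [cij _]] := gi j; have [dji [cji _]] := gj i.
apply: (schwarz r0) => [y yx||]; last 2 first.
  exact: cij.
  exact: cji.
have Uy : U y by apply: rU; rewrite -ball_normE /= distrC.
by split; [exact: fi|exact: fj|exact: dij|exact: dji].
Qed.

End Partials.

(** * Differentiability of C^1 functions and the chain rule *)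

Section Differentiability.
Variables (R : realType) (n : nat).
Implicit Types (f : 'rV[R]_n -> R) (x h : 'rV[R]_n).
Local Notation e i := (delta_mx 0 i : 'rV[R]_n).

(** Partial sums of h = sum_j h_j e_j: the corners of a path from 0 to h along the axes. *)
Definition row_prefix h k : 'rV[R]_n := \row_j (if (j < k)%N then h 0 j else 0).

Lemma row_prefixS h (k : 'I_n) : row_prefix h k.+1 = row_prefix h k + h 0 k *: e k.
Proof.
apply/rowP => j; rewrite !mxE eqxx /= ltnS leq_eqVlt.
have [<-|jk] := eqVneq j k; first by rewrite eqxx ltnn mulr1 add0r.
by rewrite (inj_eq val_inj) (negbTE jk) mulr0 addr0.
Qed.

Lemma row_prefix_bound h (k : 'I_n) (t : R) : `|t| <= `|h 0 k| ->
  `|row_prefix h k + t *: e k| <= `|h|.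
Proof.
move=> th; apply: norm_rV_le => // j; rewrite !mxE eqxx /=.
have [->|jk] := eqVneq j k.
  by rewrite ltnn mulr1 add0r (le_trans th) // norm_rV_ge.
rewrite mulr0 addr0; case: ifP => _; first exact: norm_rV_ge.
by rewrite normr0.
Qed.

Lemma increment_along_axes f x h :
  (forall y (k : 'I_n), `|y - x| <= `|h| -> derivable f y (e k)) ->
  exists2 y : 'I_n -> 'rV[R]_n, forall k, `|y k - x| <= `|h| &
    f (x + h) - f x = \sum_k h 0 k * 'D_(e k) f (y k).
Proof.
move=> df.
have H (k : 'I_n) : exists y, `|y - x| <= `|h| /\
   f (x + row_prefix h k.+1) - f (x + row_prefix h k) = h 0 k * 'D_(e k) f y.
  have [|s sh E] := @mean_value_line R _ f (x + row_prefix h k) (e k) (h 0 k).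
    move=> s sh; apply: df; rewrite -(addrA x) addrAC subrr add0r.
    exact: row_prefix_bound.
  exists (x + row_prefix h k + s *: e k); split.
    by rewrite -(addrA x) addrAC subrr add0r; exact: row_prefix_bound.
  by rewrite row_prefixS addrA.
have [y Hy] := choice H; exists y => [k|]; first by case: (Hy k).
have h0 : row_prefix h 0 = 0 by apply/rowP => j; rewrite !mxE.
have hn : row_prefix h n = h by apply/rowP => j; rewrite !mxE ltn_ord.
rewrite -{1}hn -[in f x](addr0 x) -h0.
rewrite -(telescope_sumr (fun k => f (x + row_prefix h k)) (leq0n n)) big_mkord.
by apply: eq_bigr => k _; case: (Hy k).
Qed.

(** By [increment_along_axes] the error f (x + h) - f x - L h is the sum over k of h_k
    times the variation of the k-th partial derivative between x and a point
    within |h| of x. *)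
Lemma C1_differentiable U f x : open U -> U x -> is_Ck 1 U f ->
  differentiable f x.
Proof.
move=> oU Ux [fc fd].
pose L h : R := \sum_k h 0 k * 'D_(e k) f x.
have L_lin : linear L.
  move=> a u v; rewrite /L scaler_sumr -big_split; apply: eq_bigr => k _ /=.
  by rewrite !mxE mulrDl -mulrA.
pose LM := GRing.isLinear.Build _ _ _ _ _ L_lin.
pose LL : {linear 'rV[R]_n -> R} := HB.pack L LM.
have L_cont : continuous LL.
  have -> : LL = \sum_k (fun h => h 0 k * 'D_(e k) f x) :> (_ -> _).
    by apply/funext => h; rewrite fct_sumE.
  move=> u; apply: differentiable_continuous; apply: differentiable_sum => k.
  apply: differentiableM; last exact: differentiable_cst.
  exact: differentiable_coord.
have LE : f \o shift x = cst (f x) + (LL : 'rV[R]_n -> R) +o_ (0 : 'rV[R]_n) id.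
  apply/eqaddoP => eps eps0.
  (* n.+1 rather than n, since n may be 0 *)
  have eps1 : 0 < eps / n.+1%:R by rewrite divr_gt0 // ltr0n.
  have /nbhs_ballP [r /= r0 rU] := open_nbhs_nbhs (conj oU Ux).
  have : \forall y \near x, forall k, `|'D_(e k) f x - 'D_(e k) f y| < eps / n.+1%:R.
    pose near_k k := [set y | `|'D_(e k) f x - 'D_(e k) f y| < eps / n.+1%:R].
    apply: (@filter_forall _ 'I_n near_k (nbhs x)) => k; have [_ [gc _]] := fd k.
    by have /cvgrPdist_lt /(_ _ eps1) := gc x Ux.
  move=> /nbhs_ballP [d /= d0 dH].
  suff : \forall h \near (0 : 'rV[R]_n), `|f (h + x) - (f x + L h)| <= eps * `|h| by [].
  apply/nbhs_ballP; exists (Num.min r d) => /=; first by rewrite lt_min r0 d0.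
  move=> h; rewrite -ball_normE /= sub0r normrN lt_min => /andP[hr hd].
  have [|y yh E] := @increment_along_axes f x h.
    move=> y k yh; have [fi _] := fd k; apply: fi; apply: rU.
    by rewrite -ball_normE /= distrC (le_lt_trans yh).
  rewrite opprD addrA (addrC h) E /L.
  rewrite -sumrB.
  apply: (le_trans (ler_norm_sum _ _ _)).
  apply: (@le_trans _ _ (\sum_(k < n) `|h| * (eps / n.+1%:R))).
    apply: ler_sum => k _; rewrite -mulrBr normrM ler_pM // ?norm_rV_ge //.
    rewrite distrC; apply/ltW/dH; rewrite -ball_normE /= distrC.
    exact: le_lt_trans (yh k) hd.
  rewrite sumr_const card_ord -[leLHS]mulr_natr -mulrA mulrC ler_wpM2r //.
  by rewrite -mulrA ler_piMr ?(ltW eps0) // mulrC ler_pdivrMr ?ltr0n // mul1r ler_nat.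
apply/diff_locallyP; have -> : 'd f x = LL :> (_ -> _) by exact: diff_unique.
by split.
Qed.

End Differentiability.

Section ChainRule.
Variables (R : realType) (m n : nat).
Implicit Types (x : 'rV[R]_n).

Lemma differentiable_row (phi : 'rV[R]_n -> 'rV[R]_m) x :
  (forall j, differentiable (fun y => phi y 0 j) x) -> differentiable phi x.
Proof.
move=> dphi.
have -> : phi = \sum_j (fun y => phi y 0 j *: (delta_mx 0 j : 'rV[R]_m)).
  by apply/funext => y; rewrite fct_sumE -row_sum_delta.
apply: differentiable_sum => j.
exact: differentiableZl.
Qed.

Lemma chain_rule_partial (phi : 'rV[R]_n -> 'rV[R]_m) (F : 'rV[R]_m -> R) x i :
  (forall j, differentiable (fun y => phi y 0 j) x) -> differentiable F (phi x) ->
  derivable (F \o phi) x (delta_mx 0 i) /\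
  'D_(delta_mx 0 i) (F \o phi) x =
  \sum_j 'D_(delta_mx 0 i) (fun y => phi y 0 j) x * 'D_(delta_mx 0 j) F (phi x).
Proof.
move=> dphi dF; have dp := differentiable_row dphi.
have dc := differentiable_comp dp dF.
split; first exact: diff_derivable.
rewrite deriveE // diff_comp //= [in LHS](row_sum_delta ('d phi x (delta_mx 0 i))).
rewrite linear_sum; apply: eq_bigr => j _.
rewrite linearZ /= -!deriveE //=; congr (_ * _).
rewrite derive_mx ?mxE //.
exact: diff_derivable.
Qed.
End ChainRule.

(** * Partial derivatives in a chart *)

Section ChartCalculus.
Variables (R : realType) (n : nat) (M : manifold R n).
Implicit Types (a b : cindex M) (p q : M) (f g : M -> R).
Local Notation phi a := (cphi (atlas a)).
Local Notation psi a := (cpsi (atlas a)).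

(** Used for functions smooth in another chart, which are known here only to
    have first derivatives. *)
Definition pdiff a f p : Prop :=
  forall i, derivable (f \o psi a) (phi a p) (delta_mx 0 i).

Lemma pd_near a i f g p : dom a p -> (\forall q \near p, f q = g q) ->
  pd a i f p = pd a i g p.
Proof.
move=> ap fg; apply: near_eq_derive => /=.
have pc := @cpsi_continuous _ _ _ (atlas a) (phi a p) (imageP _ ap).
by apply: (pc (fun q => f q = g q)); rewrite cphiK.
Qed.

Lemma pd_ext a i f g p : dom a p -> (forall q, dom a q -> f q = g q) ->
  pd a i f p = pd a i g p.
Proof.
move=> ap fg; apply: pd_near => //.
have := open_nbhs_nbhs (conj (cdom_open (atlas a)) ap).
by apply: filterS.
Qed.

Lemma pd_eq a i f g p : f =1 g -> pd a i f p = pd a i g p.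
Proof. by move=> /funext ->. Qed.

Lemma pd_cst a i (c : R) p : pd a i (fun=> c) p = 0.
Proof. by rewrite /pd -[X in derive X]/(cst c) derive_cst. Qed.

Lemma pdiff_cst a (c : R) p : pdiff a (fun=> c) p.
Proof. by move=> i; exact: derivable_cst. Qed.

Lemma pdD a i f g p : pdiff a f p -> pdiff a g p ->
  pd a i (fun q => f q + g q) p = pd a i f p + pd a i g p.
Proof. by move=> df dg; exact: (deriveD (df i) (dg i)). Qed.

Lemma pdiffD a f g p : pdiff a f p -> pdiff a g p ->
  pdiff a (fun q => f q + g q) p.
Proof. by move=> df dg i; exact: (derivableD (df i) (dg i)). Qed.

Lemma pdN a i f p : pdiff a f p ->
  pd a i (fun q => - f q) p = - pd a i f p.
Proof. by move=> df; exact: (deriveN (df i)). Qed.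

Lemma pdM a i f g p : dom a p -> pdiff a f p -> pdiff a g p ->
  pd a i (fun q => f q * g q) p = pd a i f p * g p + f p * pd a i g p.
Proof.
move=> ap df dg; rewrite /pd [LHS](deriveM (df i) (dg i)).
rewrite /= cphiK // addrC; congr (_ + _); exact: mulrC.
Qed.

Lemma pdiffM a f g p : pdiff a f p -> pdiff a g p ->
  pdiff a (fun q => f q * g q) p.
Proof. by move=> df dg i; exact: (derivableM (df i) (dg i)). Qed.

Lemma pdiff_sum a I (r : seq I) (F : I -> M -> R) p :
  (forall j, pdiff a (F j) p) -> pdiff a (fun q => \sum_(j <- r) F j q) p.
Proof.
move=> dF; elim: r => [|j r IH].
  have -> : (fun q => \sum_(j <- [::]) F j q) = fun=> 0 :> R.
    by apply/funext => q; rewrite big_nil.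
  exact: pdiff_cst.
have -> : (fun q => \sum_(i <- j :: r) F i q) = fun q => F j q + \sum_(i <- r) F i q.
  by apply/funext => q; rewrite big_cons.
exact: (pdiffD (dF j) IH).
Qed.

Lemma pd_sum a i I (r : seq I) (F : I -> M -> R) p :
  (forall j, pdiff a (F j) p) ->
  pd a i (fun q => \sum_(j <- r) F j q) p = \sum_(j <- r) pd a i (F j) p.
Proof.
move=> dF; elim: r => [|j r IH].
  have -> : (fun q => \sum_(j <- [::]) F j q) = fun=> 0 :> R.
    by apply/funext => q; rewrite big_nil.
  by rewrite pd_cst big_nil.
have -> : (fun q => \sum_(i <- j :: r) F i q) = fun q => F j q + \sum_(i <- r) F i q.
  by apply/funext => q; rewrite big_cons.
by rewrite big_cons pdD ?IH //; exact: pdiff_sum.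
Qed.

Lemma img_open (a : cindex M) : open (phi a @` dom a). Proof. exact: cimg_open. Qed.
Arguments img_open : clear implicits.

Lemma smooth_pdiff a f p : smooth_in_chart a f -> dom a p -> pdiff a f p.
Proof.
by move=> /(_ 1%N)[_ fd] ap i; have [fi _] := fd i; apply: fi; exact: imageP.
Qed.

Lemma smooth_ext a f g : (forall q, dom a q -> f q = g q) ->
  smooth_in_chart a f -> smooth_in_chart a g.
Proof.
move=> fg fs k; refine (is_Ck_ext (img_open a) _ (fs k)) => _ [q aq <-] /=.
by rewrite cphiK // fg.
Qed.

Lemma smooth_cst a (c : R) : smooth_in_chart a (fun=> c).
Proof. by move=> k; exact: (is_Ck_cst k c (img_open a)). Qed.

Lemma smoothD a f g : smooth_in_chart a f -> smooth_in_chart a g ->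
  smooth_in_chart a (fun q => f q + g q).
Proof. by move=> fs gs k; exact: (is_CkD (img_open a) (fs k) (gs k)). Qed.

Lemma smoothM a f g : smooth_in_chart a f -> smooth_in_chart a g ->
  smooth_in_chart a (fun q => f q * g q).
Proof. by move=> fs gs k; exact: (is_CkM (img_open a) (fs k) (gs k)). Qed.

Lemma smoothN a f : smooth_in_chart a f -> smooth_in_chart a (fun q => - f q).
Proof.
move=> fs; apply: (@smooth_ext a (fun q => -1 * f q)) => [q _|].
  by rewrite mulN1r.
by apply: smoothM => //; exact: smooth_cst.
Qed.

Lemma smoothB a f g : smooth_in_chart a f -> smooth_in_chart a g ->
  smooth_in_chart a (fun q => f q - g q).
Proof. by move=> fs gs; apply: smoothD => //; exact: smoothN. Qed.

Lemma smoothV a f : (forall q, dom a q -> f q != 0) -> smooth_in_chart a f ->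
  smooth_in_chart a (fun q => (f q)^-1).
Proof.
move=> f0 fs k; refine (is_CkV (img_open a) _ (fs k)) => _ [q aq <-] /=.
by rewrite cphiK // f0.
Qed.

Lemma smooth_sum a I (r : seq I) (P : pred I) (F : I -> M -> R) :
  (forall j, smooth_in_chart a (F j)) ->
  smooth_in_chart a (fun q => \sum_(j <- r | P j) F j q).
Proof.
move=> sF; elim: r => [|j r IH].
  apply: (@smooth_ext a (fun=> 0)) => [q _|]; last exact: smooth_cst.
  by rewrite big_nil.
apply: (@smooth_ext a (fun q => (if P j then F j q else 0) + \sum_(i <- r | P i) F i q)) => [q _|].
  by rewrite big_cons; case: ifP => //; rewrite add0r.
apply: smoothD => //; case: (P j); [exact: sF|exact: smooth_cst].
Qed.

Lemma smooth_prod a I (r : seq I) (P : pred I) (F : I -> M -> R) :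
  (forall j, smooth_in_chart a (F j)) ->
  smooth_in_chart a (fun q => \prod_(j <- r | P j) F j q).
Proof.
move=> sF; elim: r => [|j r IH].
  apply: (@smooth_ext a (fun=> 1)) => [q _|]; last exact: smooth_cst.
  by rewrite big_nil.
apply: (@smooth_ext a (fun q => (if P j then F j q else 1) * \prod_(i <- r | P i) F i q)) => [q _|].
  by rewrite big_cons; case: ifP => //; rewrite mul1r.
apply: smoothM => //; case: (P j); [exact: sF|exact: smooth_cst].
Qed.

Lemma smooth_pd a i f : smooth_in_chart a f -> smooth_in_chart a (pd a i f).
Proof.
move=> fs k; have [_ fd] := fs k.+1; have [_ fk] := fd i.
refine (is_Ck_ext (img_open a) _ fk) => _ [q aq <-] /=.
by rewrite /pd cphiK.
Qed.

(** W is the whole coordinate domain for functions smooth in the chart, and the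
    overlap of two charts for the derivatives of the transition map. *)
Lemma pd_comm_on a (W : set 'rV[R]_n) f i j p : open W ->
  (forall x, W x -> phi a (psi a x) = x) -> dom a p -> W (phi a p) ->
  is_Ck 2 W (f \o psi a) ->
  pd a i (pd a j f) p = pd a j (pd a i f) p.
Proof.
move=> oW WK ap Wp fW.
have E k l : pd a k (pd a l f) p = 'D_(delta_mx 0 k) ('D_(delta_mx 0 l) (f \o psi a)) (phi a p).
  apply: near_eq_derive; apply: (near_open_eq oW Wp) => x Wx /=.
  by rewrite /pd WK.
by rewrite !E; exact: is_Ck_schwarz oW Wp fW.
Qed.

Lemma phi_psi a x : (phi a @` dom a) x -> phi a (psi a x) = x.
Proof. by move=> [q aq <-]; rewrite cphiK. Qed.

Lemma pd_comm a f i j p : smooth_in_chart a f -> dom a p ->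
  pd a i (pd a j f) p = pd a j (pd a i f) p.
Proof.
move=> fs ap; apply: (pd_comm_on _ _ (img_open a)) (fs 2%N) => //.
exact: phi_psi.
Qed.

Lemma overlap_open a b : open (phi a @` (dom a `&` dom b)).
Proof.
rewrite openE => _ [p [ap bp] <-] /=.
have pc := @cpsi_continuous _ _ _ (atlas a) (phi a p) (imageP _ ap).
have /pc : nbhs (psi a (phi a p)) (dom b).
  by rewrite cphiK //; exact: (open_nbhs_nbhs (conj (cdom_open (atlas b)) bp)).
have : nbhs (phi a p) (phi a @` dom a).
  exact: open_nbhs_nbhs (conj (img_open a) (imageP _ ap)).
rewrite /interior /= nbhs_simpl /=; apply: filterS2.
by move=> _ [q aq <-] /=; rewrite cphiK // => bq; exists q.
Qed.
Arguments overlap_open : clear implicits.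

Lemma change_of_chart a b f p : dom a p -> dom b p -> smooth_in_chart b f ->
  pdiff a f p /\
  forall i, pd a i f p = \sum_j jac a b p i j * pd b j f p.
Proof.
move=> ap bp fs.
pose T x := phi b (psi a x).
have Wp : (phi a @` (dom a `&` dom b)) (phi a p) by exists p.
have dT j : differentiable (fun x => T x 0 j) (phi a p).
  exact: (C1_differentiable (overlap_open a b) Wp (atlas_compatible a b j 1%N)).
have Tp : T (phi a p) = phi b p by rewrite /T cphiK.
have dF : differentiable (f \o psi b) (T (phi a p)).
  rewrite Tp; apply: (C1_differentiable (img_open b)) (fs 1%N); exact: imageP.
have E : \forall x \near phi a p, ((f \o psi b) \o T) x = (f \o psi a) x.
  apply: (near_open_eq (overlap_open a b) Wp) => _ [q [aq bq] <-] /=.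
  by rewrite /T cphiK // cphiK.
have H i := chain_rule_partial i dT dF.
split => i; have [H1 H2] := H i.
  exact: near_eq_derivable E H1.
rewrite /pd -(near_eq_derive _ E) H2; apply: eq_bigr => j _.
by rewrite Tp mxE.
Qed.

Lemma jac_pdiff a b p j k : dom a p -> dom b p ->
  pdiff a (fun q => jac a b q j k) p.
Proof.
move=> ap bp i.
have Wp : (phi a @` (dom a `&` dom b)) (phi a p) by exists p.
have [_ fd] := atlas_compatible a b k 2%N; have [_ [_ fj]] := fd j.
have [fji _] := fj i.
apply: near_eq_derivable (fji _ Wp).
apply: (near_open_eq (overlap_open a b) Wp) => _ [q [aq bq] <-] /=.
by rewrite mxE /pd cphiK.
Qed.

Lemma jac_symm a b p i j k : dom a p -> dom b p ->
  pd a i (fun q => jac a b q j k) p = pd a j (fun q => jac a b q i k) p.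
Proof.
move=> ap bp.
have E l : (fun q => jac a b q l k) = pd a l (fun q => phi b q 0 k).
  by apply/funext => q; rewrite mxE.
rewrite !E; apply: (pd_comm_on _ _ (overlap_open a b)) => //.
- by move=> _ [q [aq bq] <-]; rewrite cphiK.
- by exists p.
- exact: (atlas_compatible a b k 2%N).
Qed.

End ChartCalculus.

(** * Matrix-valued functions in a chart, and the connection *)

(* Entrywise rules for one operation at a time: unlike mxE they leave alone the
   matrices that are themselves defined by their entries. *)
Lemma entry_add (R : zmodType) m n (A B : 'M[R]_(m, n)) i j : (A + B) i j = A i j + B i j.
Proof. by rewrite mxE. Qed.
Lemma entry_opp (R : zmodType) m n (A : 'M[R]_(m, n)) i j : (- A) i j = - A i j.
Proof. by rewrite mxE. Qed.
Lemma entry_zero (R : zmodType) m n i j : (0 : 'M[R]_(m, n)) i j = 0.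
Proof. by rewrite mxE. Qed.

Lemma entry_mul (R : pzSemiRingType) m n k (A : 'M[R]_(m, n)) (B : 'M[R]_(n, k)) i j :
  (A *m B) i j = \sum_l A i l * B l j.
Proof. by rewrite mxE. Qed.
Lemma entry_tr (R : Type) m n (A : 'M[R]_(m, n)) i j : A^T i j = A j i.
Proof. by rewrite mxE. Qed.

(* The rules of the matrix calculus at a realType, so that rewriting with them
   always produces the same ring structure and equal products stay
   syntactically equal. *)
Section MatrixDistributivity.
Variables (R : realType) (m n k l : nat).
Implicit Types (A : 'M[R]_(m, n)) (B : 'M[R]_(n, k)) (C : 'M[R]_(k, l)).
Lemma mulmx_addl A A' B : (A + A') *m B = A *m B + A' *m B. Proof. exact: mulmxDl. Qed.
Lemma mulmx_addr A B B' : A *m (B + B') = A *m B + A *m B'. Proof. exact: mulmxDr. Qed.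
Lemma mulmx_oppl A B : (- A) *m B = - (A *m B). Proof. exact: mulNmx. Qed.
Lemma mulmx_oppr A B : A *m (- B) = - (A *m B). Proof. exact: mulmxN. Qed.
Lemma mulmx_assoc A B C : A *m (B *m C) = A *m B *m C. Proof. exact: mulmxA. Qed.
Lemma trmx_add A A' : (A + A')^T = A^T + A'^T. Proof. exact: linearD. Qed.
Lemma trmx_opp A : (- A)^T = - A^T. Proof. exact: linearN. Qed.
Lemma trmx_prod A B : (A *m B)^T = B^T *m A^T. Proof. exact: trmx_mul. Qed.
End MatrixDistributivity.

(** Proves identities of matrices with noncommuting products: after expansion each
    product is an atom of a linear identity between entries. *)
Ltac mx_abel :=
  rewrite ?(trmx_add, trmx_opp, trmx_prod, trmxK)
    ?(mulmx_addl, mulmx_addr, mulmx_oppl, mulmx_oppr, mulmx_assoc);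
  apply/matrixP => ? ?; rewrite ?(entry_add, entry_opp, entry_zero);
  repeat match goal with |- context [@fun_of_matrix ?T ?r ?c ?X ?i ?j] =>
     generalize (@fun_of_matrix T r c X i j); intro end; ring.

(** Locked, because unification would otherwise unfold entries into limits. *)
HB.lock Definition mx_pd (R : realType) (n : nat) (M : manifold R n) (a : cindex M)
    (r c : nat) (i : 'I_n) (X : M -> 'M[R]_(r, c)) (p : M) : 'M[R]_(r, c) :=
  \matrix_(k, l) pd a i (fun q => X q k l) p.
Arguments mx_pd {R n M} a {r c} i X p.

Section MatrixCalculus.
Variables (R : realType) (n : nat) (M : manifold R n) (a : cindex M).
Implicit Types (p q : M).

Definition mx_pdiff r c (X : M -> 'M[R]_(r, c)) p : Prop :=
  forall k l, pdiff a (fun q => X q k l) p.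
Definition mx_smooth r c (X : M -> 'M[R]_(r, c)) : Prop :=
  forall k l, smooth_in_chart a (fun q => X q k l).

Lemma mx_pdE r c i (X : M -> 'M[R]_(r, c)) p k l :
  mx_pd a i X p k l = pd a i (fun q => X q k l) p.
Proof. by rewrite mx_pd.unlock mxE. Qed.

Lemma mx_smooth_pdiff r c (X : M -> 'M[R]_(r, c)) p :
  mx_smooth X -> dom a p -> mx_pdiff X p.
Proof. by move=> sX ap k l; exact: smooth_pdiff. Qed.

Lemma mx_pd_near r c i (X Y : M -> 'M[R]_(r, c)) p : dom a p ->
  (\forall q \near p, X q = Y q) -> mx_pd a i X p = mx_pd a i Y p.
Proof.
move=> ap XY; apply/matrixP => k l; rewrite !mx_pdE; apply: pd_near => //.
by apply: filterS XY => q ->.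
Qed.

Lemma mx_pd_ext r c i (X Y : M -> 'M[R]_(r, c)) p : dom a p ->
  (forall q, dom a q -> X q = Y q) -> mx_pd a i X p = mx_pd a i Y p.
Proof.
by move=> ap XY; apply/matrixP => k l; rewrite !mx_pdE; apply: pd_ext => // q /XY ->.
Qed.

Lemma mx_smooth_ext r c (X Y : M -> 'M[R]_(r, c)) :
  (forall q, dom a q -> X q = Y q) -> mx_smooth X -> mx_smooth Y.
Proof. by move=> XY sX k l; apply: smooth_ext (sX k l) => q /XY ->. Qed.

Lemma mx_pd_cst r c i (X : 'M[R]_(r, c)) p : mx_pd a i (fun=> X) p = 0.
Proof. by apply/matrixP => k l; rewrite mx_pdE pd_cst entry_zero. Qed.

Lemma mx_pdD r c i (X Y : M -> 'M[R]_(r, c)) p : mx_pdiff X p -> mx_pdiff Y p ->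
  mx_pd a i (fun q => X q + Y q) p = mx_pd a i X p + mx_pd a i Y p.
Proof.
move=> dX dY; apply/matrixP => k l; rewrite entry_add !mx_pdE -pdD //.
by apply: pd_eq => q; rewrite mxE.
Qed.

Lemma mx_pdN r c i (X : M -> 'M[R]_(r, c)) p : mx_pdiff X p ->
  mx_pd a i (fun q => - X q) p = - mx_pd a i X p.
Proof.
move=> dX; apply/matrixP => k l; rewrite entry_opp !mx_pdE -pdN //.
by apply: pd_eq => q; rewrite mxE.
Qed.

Lemma mx_pd_tr r c i (X : M -> 'M[R]_(r, c)) p :
  mx_pd a i (fun q => (X q)^T) p = (mx_pd a i X p)^T.
Proof.
apply/matrixP => k l; rewrite entry_tr !mx_pdE.
by apply: pd_eq => q; rewrite mxE.
Qed.

Lemma mx_pdM r c d i (X : M -> 'M[R]_(r, c)) (Y : M -> 'M[R]_(c, d)) p :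
  dom a p -> mx_pdiff X p -> mx_pdiff Y p ->
  mx_pd a i (fun q => X q *m Y q) p = mx_pd a i X p *m Y p + X p *m mx_pd a i Y p.
Proof.
move=> ap dX dY; apply/matrixP => k l; rewrite entry_add mx_pdE !entry_mul -big_split /=.
transitivity (pd a i (fun q => \sum_j X q k j * Y q j l) p).
  by apply: pd_eq => q; rewrite mxE.
rewrite pd_sum => [|j]; last by apply: pdiffM; [exact: dX|exact: dY].
by apply: eq_bigr => j _; rewrite pdM // !mx_pdE.
Qed.

Lemma mx_pdiffM r c d (X : M -> 'M[R]_(r, c)) (Y : M -> 'M[R]_(c, d)) p :
  mx_pdiff X p -> mx_pdiff Y p -> mx_pdiff (fun q => X q *m Y q) p.
Proof.
move=> dX dY k l.
have -> : (fun q => (X q *m Y q) k l) = fun q => \sum_j X q k j * Y q j l.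
  by apply/funext => q; rewrite mxE.
by apply: pdiff_sum => j; apply: pdiffM; [exact: dX|exact: dY].
Qed.

Lemma mx_pdiff_tr r c (X : M -> 'M[R]_(r, c)) p :
  mx_pdiff X p -> mx_pdiff (fun q => (X q)^T) p.
Proof.
move=> dX k l; have -> : (fun q => (X q)^T k l) = fun q => X q l k.
  by apply/funext => q; rewrite mxE.
exact: dX.
Qed.

Lemma mx_smoothD r c (X Y : M -> 'M[R]_(r, c)) :
  mx_smooth X -> mx_smooth Y -> mx_smooth (fun q => X q + Y q).
Proof.
move=> sX sY k l; apply: smooth_ext (smoothD (sX k l) (sY k l)) => q _.
by rewrite mxE.
Qed.

Lemma mx_smoothN r c (X : M -> 'M[R]_(r, c)) :
  mx_smooth X -> mx_smooth (fun q => - X q).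
Proof. by move=> sX k l; apply: smooth_ext (smoothN (sX k l)) => q _; rewrite mxE. Qed.

Lemma mx_smooth_tr r c (X : M -> 'M[R]_(r, c)) :
  mx_smooth X -> mx_smooth (fun q => (X q)^T).
Proof. by move=> sX k l; apply: smooth_ext (sX l k) => q _; rewrite mxE. Qed.

Lemma mx_smoothZ r c f (X : M -> 'M[R]_(r, c)) :
  smooth_in_chart a f -> mx_smooth X -> mx_smooth (fun q => f q *: X q).
Proof. by move=> sf sX k l; apply: smooth_ext (smoothM sf (sX k l)) => q _; rewrite mxE. Qed.

Lemma mx_smoothM r c d (X : M -> 'M[R]_(r, c)) (Y : M -> 'M[R]_(c, d)) :
  mx_smooth X -> mx_smooth Y -> mx_smooth (fun q => X q *m Y q).
Proof.
move=> sX sY k l.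
apply: (@smooth_ext _ _ _ a (fun q => \sum_j X q k j * Y q j l)) => [q _|].
  by rewrite mxE.
by apply: smooth_sum => j; apply: smoothM; [exact: sX|exact: sY].
Qed.

Lemma mx_smooth_pd r c i (X : M -> 'M[R]_(r, c)) :
  mx_smooth X -> mx_smooth (mx_pd a i X).
Proof. by move=> sX k l; apply: smooth_ext (smooth_pd i (sX k l)) => q _; rewrite mx_pdE. Qed.

Lemma smooth_trace m (X : M -> 'M[R]_m) : mx_smooth X -> smooth_in_chart a (fun q => \tr (X q)).
Proof. by move=> sX; apply: smooth_sum => k; exact: sX. Qed.

Lemma smooth_det m (X : M -> 'M[R]_m) : mx_smooth X ->
  smooth_in_chart a (fun q => \det (X q)).
Proof.
move=> sX; rewrite /determinant; apply: smooth_sum => s.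
apply: smoothM; first exact: smooth_cst.
by apply: smooth_prod => k; exact: sX.
Qed.

Lemma mx_smoothV m (X : M -> 'M[R]_m) : (forall q, dom a q -> X q \in unitmx) ->
  mx_smooth X -> mx_smooth (fun q => invmx (X q)).
Proof.
move=> uX sX.
apply: (@mx_smooth_ext _ _ (fun q => (\det (X q))^-1 *: \adj (X q))) => [q aq|].
  by rewrite /invmx uX.
apply: mx_smoothZ.
  apply: smoothV; last exact: smooth_det.
  by move=> q /uX; rewrite unitmxE unitfE.
move=> k l.
apply: (@smooth_ext _ _ _ a (fun q => (-1) ^+ (l + k) * \det (row' l (col' k (X q))))).
  by move=> q _; rewrite mxE.
apply: smoothM; first exact: smooth_cst.
apply: smooth_det => u w; apply: smooth_ext (sX (lift l u) (lift k w)) => q _.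
by rewrite !mxE.
Qed.

Lemma mx_pd_comm r c i j (X : M -> 'M[R]_(r, c)) p : mx_smooth X -> dom a p ->
  mx_pd a i (mx_pd a j X) p = mx_pd a j (mx_pd a i X) p.
Proof.
move=> sX ap; apply/matrixP => k l; rewrite [LHS]mx_pdE [RHS]mx_pdE.
have E u v : pd a u (fun q => mx_pd a v X q k l) p = pd a u (pd a v (fun q => X q k l)) p.
  by apply: pd_eq => q; rewrite mx_pdE.
by rewrite (E i j) (E j i); exact: pd_comm (sX k l) ap.
Qed.

End MatrixCalculus.

(** The connection matrix of the direction i: for a row vector W of components of
    a vector field, nabla_i W = d_i W + W (conn i). *)
HB.lock Definition conn (R : realType) (n : nat) (M : spacetime R n) (a : cindex M)
    (i : 'I_n) (p : M) : 'M[R]_n := \matrix_(l, k) christoffel a k i l p.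
Arguments conn {R n M} a i p.

Section Metric.
Variables (R : realType) (n : nat) (M : spacetime R n) (a : cindex M).
Implicit Types (p q : M).
Local Notation G := (metric a).
Local Notation P := (inv_metric a).

Lemma metric_trmx p : dom a p -> (G p)^T = G p.
Proof. by move=> ap; have [] := metric_lorentzian ap. Qed.

Lemma minkowski_unit : Defs.minkowski R n \in unitmx.
Proof.
have E : Defs.minkowski R n *m Defs.minkowski R n = 1%:M.
  apply/matrixP => i j; rewrite !mxE (bigD1 i) //= big1 => [|k ki].
    rewrite !mxE eqxx addr0; case: (eqVneq i j) => [_|ij] /=; last by rewrite mulr0.
    by case: ifP => _; rewrite ?mulrNN mulr1.
  by rewrite !mxE eq_sym (negbTE ki) mul0r.
by have [] := mulmx1_unit E.
Qed.

Lemma metric_unit p : dom a p -> G p \in unitmx.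
Proof.
move=> ap; have [_ [Q uQ E]] := metric_lorentzian ap.
have := minkowski_unit; rewrite -E !unitmx_mul => /andP[/andP[]] //.
Qed.

Lemma inv_metricM p : dom a p -> P p *m G p = 1%:M.
Proof. by move=> ap; rewrite mulVmx ?metric_unit. Qed.

Lemma metricMinv p : dom a p -> G p *m P p = 1%:M.
Proof. by move=> ap; rewrite mulmxV ?metric_unit. Qed.

Lemma inv_metric_sym p : dom a p -> (P p)^T = P p.
Proof. by move=> ap; rewrite /inv_metric trmx_inv metric_trmx. Qed.

Lemma metric_smooth : mx_smooth a G.
Proof. by have [sG _] := metric_field M; exact: sG. Qed.

Lemma inv_metric_smooth : mx_smooth a P.
Proof. by apply: mx_smoothV => [q|]; [exact: metric_unit|exact: metric_smooth]. Qed.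

(** The entry (j, l) is twice the Christoffel symbol of the first kind. *)
Definition christoffel1 i p : 'M[R]_n :=
  \matrix_(j, l) (pd a i (fun q => G q j l) p + pd a j (fun q => G q i l) p
     - pd a l (fun q => G q i j) p).


Lemma conn_entry i p l k : conn a i p l k = christoffel a k i l p.
Proof. by rewrite conn.unlock mxE. Qed.

Lemma connE i p : dom a p -> conn a i p = 2^-1 *: (christoffel1 i p *m P p).
Proof.
move=> ap; apply/matrixP => l k; rewrite conn_entry !mxE; congr (_ * _).
apply: eq_bigr => m _; rewrite !mxE mulrC -[in RHS](inv_metric_sym ap) !mxE //.
Qed.

Lemma metric_entry_sym i j q : dom a q -> G q i j = G q j i.
Proof. by move=> aq; rewrite -[in LHS](metric_trmx aq) mxE. Qed.

Lemma christoffel_sym k i j p : dom a p -> christoffel a k i j p = christoffel a k j i p.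
Proof.
move=> ap; rewrite /christoffel; congr (_ * _); apply: eq_bigr => l _; congr (_ * _).
rewrite (addrC (pd a i _ p)); congr (_ - _).
by apply: pd_ext => // q; exact: metric_entry_sym.
Qed.

Lemma conn_sym i l k p : dom a p -> conn a i p l k = conn a l p i k.
Proof. by move=> ap; rewrite !conn_entry christoffel_sym. Qed.

Lemma conn_smooth i : mx_smooth a (conn a i).
Proof.
apply: (@mx_smooth_ext _ _ _ _ _ _ (fun p => 2^-1 *: (christoffel1 i p *m P p))).
  by move=> q aq; rewrite connE.
apply: mx_smoothZ; first exact: smooth_cst.
apply: mx_smoothM; last exact: inv_metric_smooth.
move=> j l; apply: (@smooth_ext _ _ _ a (fun p => pd a i (fun q => G q j l) p
   + pd a j (fun q => G q i l) p - pd a l (fun q => G q i j) p)).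
  by move=> q _; rewrite mxE.
by apply: smoothB; [apply: smoothD|]; apply: smooth_pd; exact: metric_smooth.
Qed.

Lemma christoffel1_tr i p : dom a p ->
  christoffel1 i p + (christoffel1 i p)^T = 2 *: mx_pd a i G p.
Proof.
move=> ap; apply/matrixP => j l; rewrite !mxE mx_pdE.
have -> : pd a i (fun q => G q l j) p = pd a i (fun q => G q j l) p.
  by apply: pd_ext => // q; exact: metric_entry_sym.
ring.
Qed.

Lemma conn_metric i p : dom a p -> conn a i p *m G p = 2^-1 *: christoffel1 i p.
Proof.
by move=> ap; rewrite connE // -scalemxAl -mulmxA inv_metricM // mulmx1.
Qed.

(** nabla g = 0: the entries of conn i g are half the Christoffel symbols of the
    first kind, whose symmetrisation is d_i g. *)
Lemma metric_parallel i p : dom a p ->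
  mx_pd a i G p = conn a i p *m G p + G p *m (conn a i p)^T.
Proof.
move=> ap; have -> : G p *m (conn a i p)^T = (conn a i p *m G p)^T.
  by rewrite trmx_mul metric_trmx.
rewrite conn_metric // linearZ /= -scalerDr christoffel1_tr // scalerA mulVf ?scale1r //.
Qed.

(** Differentiating g^-1 g = 1. *)
Lemma inv_metric_parallel i p : dom a p ->
  mx_pd a i P p = - (P p *m conn a i p + (conn a i p)^T *m P p).
Proof.
move=> ap.
have dP := mx_smooth_pdiff inv_metric_smooth ap.
have dG := mx_smooth_pdiff metric_smooth ap.
have : mx_pd a i (fun q => P q *m G q) p = 0.
  rewrite -(mx_pd_cst a i 1%:M p); apply: mx_pd_ext => // q; exact: inv_metricM.
rewrite mx_pdM // metric_parallel // => /(congr1 (fun X => X *m P p)).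
rewrite mul0mx !mulmxDr !mulmxDl -!mulmxA metricMinv // !mulmx1.
rewrite (mulmxA (P p) (G p)) inv_metricM // mul1mx.
by move/eqP; rewrite addr_eq0 => /eqP.
Qed.

End Metric.

(** * Curvature and the contracted Bianchi identity *)

(** The endomorphism R(d_i, d_j), acting on row vectors, whence the order of the
    factors in the commutator. *)
HB.lock Definition curv (R : realType) (n : nat) (M : spacetime R n) (a : cindex M)
    (i j : 'I_n) (p : M) : 'M[R]_n :=
  mx_pd a i (conn a j) p - mx_pd a j (conn a i) p
  + (conn a j p *m conn a i p - conn a i p *m conn a j p).
Arguments curv {R n M} a i j p.

(** R(d_i, d_j) with its lower endomorphism index raised, which makes it
    antisymmetric in both pairs of indices ([curv_up_tr]). *)
HB.lock Definition curv_up (R : realType) (n : nat) (M : spacetime R n) (a : cindex M)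
    (i j : 'I_n) (p : M) : 'M[R]_n := inv_metric a p *m curv a i j p.
Arguments curv_up {R n M} a i j p.

Section Curvature.
Variables (R : realType) (n : nat) (M : spacetime R n) (a : cindex M).
Implicit Types (p q : M).
Local Notation G := (metric a).
Local Notation P := (inv_metric a).
Local Notation D := (mx_pd a).
Local Notation Gam := (conn a).

Lemma curv_def i j p : curv a i j p =
  D i (Gam j) p - D j (Gam i) p + (Gam j p *m Gam i p - Gam i p *m Gam j p).
Proof. by rewrite curv.unlock. Qed.

Lemma curv_smooth i j : mx_smooth a (curv a i j).
Proof.
have sG k := @conn_smooth _ _ M a k.
apply: (@mx_smooth_ext _ _ _ _ _ _ _ _ (fun q _ => esym (curv_def i j q))).
apply: mx_smoothD; try apply: mx_smoothD; try apply: mx_smoothN;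
  by [apply: mx_smooth_pd|apply: mx_smoothM].
Qed.

Lemma curvE i j k l p : curv a i j p k l = curvature a i j k l p.
Proof.
rewrite !curv_def !entry_add !entry_opp !entry_mul !mx_pdE.
have E u v : pd a u (fun q => Gam v q k l) p = pd a u (christoffel a l v k) p.
  by apply: pd_eq => q; rewrite conn_entry.
rewrite (E i j) (E j i) -sumrB; congr (_ + _); apply: eq_bigr => m _.
by rewrite !conn_entry mulrC [X in _ - X]mulrC.
Qed.

Lemma curvN i j p : curv a i j p = - curv a j i p.
Proof. rewrite !curv_def; mx_abel. Qed.

Lemma D_conn_mul i j k p : dom a p ->
  D k (fun q => Gam i q *m Gam j q) p = D k (Gam i) p *m Gam j p + Gam i p *m D k (Gam j) p.
Proof. by move=> ap; apply: mx_pdM => //; apply: mx_smooth_pdiff ap; exact: conn_smooth. Qed.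

Lemma D_curv k i j p : dom a p -> D k (curv a i j) p =
  D k (D i (Gam j)) p - D k (D j (Gam i)) p +
  (D k (Gam j) p *m Gam i p + Gam j p *m D k (Gam i) p
   - (D k (Gam i) p *m Gam j p + Gam i p *m D k (Gam j) p)).
Proof.
move=> ap; have sG u := @conn_smooth _ _ M a u.
have sD u v : mx_smooth a (D u (Gam v)) by exact: mx_smooth_pd.
have sM u v : mx_smooth a (fun q => Gam u q *m Gam v q) by exact: mx_smoothM.
have sN X : mx_smooth a X -> mx_pdiff a (fun q => - X q : 'M[R]_n) p.
  by move=> sX; apply: mx_smooth_pdiff ap; exact: mx_smoothN.
have dD u v := mx_smooth_pdiff (sD u v) ap.
have dM u v := mx_smooth_pdiff (sM u v) ap.
rewrite (mx_pd_ext k ap (fun q _ => curv_def i j q)) [LHS]mx_pdD; last 2 first.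
- by apply: mx_smooth_pdiff ap; apply: mx_smoothD => //; exact: mx_smoothN.
- by apply: mx_smooth_pdiff ap; apply: mx_smoothD => //; exact: mx_smoothN.
rewrite [in LHS]mx_pdD //; last exact: sN.
rewrite [X in _ + X = _]mx_pdD //; last exact: sN.
by rewrite !mx_pdN // !D_conn_mul.
Qed.

(** Only the endomorphism indices are differentiated covariantly: the corrections
    for the form indices i and j cancel in the cyclic sum below. *)
Definition cov_curv k i j p :=
  D k (curv a i j) p + curv a i j p *m Gam k p - Gam k p *m curv a i j p.

(** The second Bianchi identity.  Second derivatives of the connection cancel by
    symmetry, the products of a derivative and a connection matrix in pairs, and
    the cubic terms by the Jacobi identity. *)
Lemma bianchi2 k i j p : dom a p ->
  cov_curv k i j p + cov_curv i j k p + cov_curv j k i p = 0.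
Proof.
move=> ap; have sG u := @conn_smooth _ _ M a u.
rewrite /cov_curv !D_curv //.
rewrite (mx_pd_comm k i (sG j) ap) (mx_pd_comm k j (sG i) ap) (mx_pd_comm i j (sG k) ap).
rewrite !curv_def; mx_abel.
Qed.

(** The curvature is skew-adjoint: antisymmetrise the second derivatives of g,
    computed from nabla g = 0. *)
Lemma curv_metric i j p : dom a p -> curv a i j p *m G p + G p *m (curv a i j p)^T = 0.
Proof.
move=> ap; have sC u := @conn_smooth _ _ M a u.
have sM := @metric_smooth _ _ M a.
have dC u := mx_smooth_pdiff (sC u) ap.
have dG := mx_smooth_pdiff sM ap.
have E u v : D u (D v G) p = D u (Gam v) p *m G p + Gam v p *m (Gam u p *m G p + G p *m (Gam u p)^T)
   + ((Gam u p *m G p + G p *m (Gam u p)^T) *m (Gam v p)^T + G p *m (D u (Gam v) p)^T).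
  rewrite (mx_pd_ext u ap (@metric_parallel _ _ M a v)).
  rewrite mx_pdD; last 2 first.
  - by apply: mx_smooth_pdiff ap; apply: mx_smoothM.
  - by apply: mx_smooth_pdiff ap; apply: mx_smoothM => //; exact: mx_smooth_tr.
  rewrite (mx_pdM u ap (dC v) dG) (mx_pdM u ap dG (mx_pdiff_tr (dC v))).
  by rewrite mx_pd_tr (metric_parallel u ap).
have := mx_pd_comm i j sM ap; rewrite !E => /eqP; rewrite -subr_eq0 => /eqP H.
rewrite -[RHS]H !curv_def; mx_abel.
Qed.

Lemma curv_up_def i j p : curv_up a i j p = P p *m curv a i j p.
Proof. by rewrite curv_up.unlock. Qed.

Lemma curv_up_tr i j p : dom a p -> (curv_up a i j p)^T = - curv_up a i j p.
Proof.
move=> ap; have := curv_metric i j ap.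
move=> /(congr1 (fun X => P p *m X *m P p)); rewrite mulmx0 mul0mx.
rewrite mulmxDr mulmxDl -!mulmxA metricMinv // !mulmx1 (mulmxA (P p) (G p)) inv_metricM //.
rewrite mul1mx !curv_up_def trmx_mul inv_metric_sym // => /eqP.
by rewrite addrC addr_eq0 => /eqP.
Qed.

Lemma curv_upN i j p : curv_up a i j p = - curv_up a j i p.
Proof. by rewrite !curv_up_def curvN mulmxN. Qed.

Lemma curv_up_anti i j k l p : dom a p -> curv_up a i j p k l = - curv_up a i j p l k.
Proof. by move=> ap; rewrite -entry_opp -curv_up_tr // entry_tr. Qed.

(** Covariant derivative of a contravariant 2-tensor. *)
Definition cov_up k (X : M -> 'M[R]_n) p : 'M[R]_n :=
  D k X p + X p *m Gam k p + (Gam k p)^T *m X p.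

Lemma curv_up_smooth i j : mx_smooth a (curv_up a i j).
Proof.
apply: (@mx_smooth_ext _ _ _ _ _ _ _ _ (fun q _ => esym (curv_up_def i j q))).
by apply: mx_smoothM; [exact: inv_metric_smooth|exact: curv_smooth].
Qed.

Lemma cov_curv_up k i j p : dom a p -> cov_up k (curv_up a i j) p = P p *m cov_curv k i j p.
Proof.
move=> ap; rewrite /cov_up (mx_pd_ext k ap (fun q _ => curv_up_def i j q)) !curv_up_def.
rewrite mx_pdM //; last 2 first.
- by apply: mx_smooth_pdiff ap; exact: inv_metric_smooth.
- by apply: mx_smooth_pdiff ap; exact: curv_smooth.
rewrite inv_metric_parallel // /cov_curv; mx_abel.
Qed.

Lemma ricci_operatorE m l p : dom a p -> ricci_operator a p m l = \sum_i curv_up a i m p l i.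
Proof.
move=> ap; rewrite entry_mul.
under eq_bigr => k _ do rewrite mxE mulr_suml.
rewrite exchange_big; apply: eq_bigr => i _; rewrite curv_up_def entry_mul; apply: eq_bigr => k _.
rewrite curvE mulrC; congr (_ * _).
by rewrite -[in LHS](inv_metric_sym ap) entry_tr.
Qed.

Lemma ricci_operator_smooth : mx_smooth a (ricci_operator a).
Proof.
move=> m l; apply: (@smooth_ext _ _ _ a (fun p => \sum_i curv_up a i m p l i)).
  by move=> q aq; rewrite ricci_operatorE.
by apply: smooth_sum => i; exact: curv_up_smooth.
Qed.

(** The divergence of a field of operators, sum_i (nabla_i X)_m^i. *)
Definition div_mx m (X : M -> 'M[R]_n) p : R :=
  \sum_i (D i X p + X p *m Gam i p) m i - \tr (X p *m Gam m p).

Lemma div_mx_ext m X Y p : dom a p -> (forall q, dom a q -> X q = Y q) ->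
  div_mx m X p = div_mx m Y p.
Proof.
move=> ap XY; rewrite /div_mx (XY p ap); congr (_ - _).
by apply: eq_bigr => i _; rewrite (mx_pd_ext i ap XY).
Qed.

(** Contract the second Bianchi identity, in the form with both endomorphism
    indices up, over row = j and column = i.  The first term of the cyclic sum
    gives the derivative of the scalar curvature, up to twice tr (r Gam_m), and
    each of the other two gives minus the divergence, up to the same trace;
    contractions of the connection with an antisymmetric pair vanish because it
    is torsion-free. *)
Lemma contracted_bianchi m p : dom a p ->
  pd a m (fun q => \tr (ricci_operator a q)) p = 2 * div_mx m (ricci_operator a) p.
Proof.
move=> ap; set r := ricci_operator a.
have dW i j := mx_smooth_pdiff (curv_up_smooth i j) ap.
have rE k l q : dom a q -> r q k l = \sum_i curv_up a i k q l i by exact: ricci_operatorE.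
have rE2 k l q : dom a q -> r q k l = \sum_j curv_up a k j q j l.
  move=> aq; rewrite rE //; apply: eq_bigr => j _.
  by rewrite curv_upN -curv_up_tr // entry_tr.
have T1 : \sum_i \sum_j cov_up m (curv_up a i j) p j i =
    pd a m (fun q => \tr (r q)) p + 2 * \tr (r p *m Gam m p).
  under eq_bigr => i _ do under eq_bigr => j _ do rewrite /cov_up !entry_add.
  under eq_bigr => i _ do rewrite !big_split /=.
  rewrite !big_split /= -addrA; congr (_ + _).
    rewrite (@pd_ext _ _ _ _ _ _ (fun q => \sum_i \sum_j curv_up a i j q j i)) //; last first.
      move=> q aq; rewrite exchange_big; apply: eq_bigr => k _; exact: rE.
    rewrite pd_sum => [|i]; last by apply: pdiff_sum => j; exact: dW.
    apply: eq_bigr => i _; rewrite pd_sum => [|j]; last exact: dW.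
    by apply: eq_bigr => j _; rewrite mx_pdE.
  rewrite mulr_natl mulr2n; congr (_ + _).
    rewrite /mxtrace; apply: eq_bigr => i _; rewrite entry_mul.
    under eq_bigr => j _ do rewrite entry_mul.
    rewrite exchange_big; apply: eq_bigr => l _; rewrite rE2 // mulr_suml.
    by apply: eq_bigr.
  rewrite exchange_big /mxtrace; apply: eq_bigr => j _ /=; rewrite entry_mul.
  under eq_bigr => i _ do rewrite entry_mul.
  rewrite exchange_big; apply: eq_bigr => k _ /=; rewrite rE // mulr_suml.
  by apply: eq_bigr => i _; rewrite entry_tr mulrC.
have T2 : \sum_i \sum_j cov_up i (curv_up a j m) p j i = - \sum_i (D i r p + r p *m Gam i p) m i.
  under eq_bigr => i _ do under eq_bigr => j _ do rewrite /cov_up !entry_add.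
  under eq_bigr => i _ do rewrite !big_split /=.
  rewrite !big_split /= -sumrN.
  under [RHS]eq_bigr => i _ do rewrite entry_add opprD.
  rewrite big_split /= -[RHS]addr0; congr (_ + _ + _).
  - apply: eq_bigr => i _; rewrite mx_pdE.
    rewrite (@pd_ext _ _ _ _ _ _ (fun q => \sum_j curv_up a j m q i j)) //; last first.
      by move=> q aq; exact: rE.
    rewrite pd_sum => [|j]; last exact: dW.
    rewrite -sumrN; apply: eq_bigr => j _; rewrite mx_pdE -pdN; last exact: dW.
    apply: pd_ext => // q aq.
    by rewrite [in LHS]curv_up_anti //.
  - apply: eq_bigr => i _; rewrite entry_mul -sumrN.
    under eq_bigr => j _ do rewrite entry_mul.
    rewrite exchange_big; apply: eq_bigr => l _ /=; rewrite rE // -mulNr -mulr_suml -sumrN.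
    congr (_ * _); apply: eq_bigr => j _.
    by rewrite [in LHS]curv_up_anti //.
  - rewrite exchange_big big1 // => j _.
    under eq_bigr => i _ do rewrite entry_mul.
    set S := \sum_i _; suff : S = - S by move=> /eqP; rewrite -addr_eq0 -mulr2n mulrn_eq0 /= => /eqP.
    rewrite {1}/S exchange_big /S -sumrN; apply: eq_bigr => i _.
    rewrite -sumrN; apply: eq_bigr => k _; rewrite !entry_tr !conn_entry.
    by rewrite [in LHS]curv_up_anti // mulrN (christoffel_sym _ _ _ ap).
(* transposition exchanges the last two terms of the cyclic sum *)
have T3 : \sum_i \sum_j cov_up j (curv_up a m i) p j i = \sum_i \sum_j cov_up i (curv_up a j m) p j i.
  rewrite exchange_big; apply: eq_bigr => j _; apply: eq_bigr => i _.
  have H : (cov_up j (curv_up a m i) p)^T = cov_up j (curv_up a i m) p.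
    rewrite /cov_up !trmx_add !trmx_prod trmxK -mx_pd_tr.
    rewrite (mx_pd_ext j ap (Y := curv_up a i m)).
      by rewrite curv_up_tr // -curv_upN addrAC.
    by move=> q aq; rewrite curv_up_tr // -curv_upN.
  by rewrite -H entry_tr.
have : \sum_i \sum_j (P p *m (cov_curv m i j p + cov_curv i j m p + cov_curv j m i p)) j i = 0.
  rewrite big1 // => i _; rewrite big1 // => j _.
  by rewrite bianchi2 // mulmx0 entry_zero.
have E i j : (P p *m (cov_curv m i j p + cov_curv i j m p + cov_curv j m i p)) j i =
    cov_up m (curv_up a i j) p j i + cov_up i (curv_up a j m) p j i + cov_up j (curv_up a m i) p j i.
  by rewrite !cov_curv_up // -!entry_add -!mulmxDr.
under eq_bigr => i _ do under eq_bigr => j _ do rewrite E.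
under eq_bigr => i _ do rewrite !big_split /=.
rewrite !big_split /= T3 T2 T1 /div_mx.
move: (pd a m _ p) (\tr _) (\sum_i _) => x y z H.
apply/eqP; rewrite -subr_eq0; apply/eqP; rewrite -[RHS]H; ring.
Qed.

End Curvature.

(** * The Ricci identity and the Raychaudhuri equation *)

Section RicciIdentity.
Variables (R : realType) (n : nat) (M : spacetime R n) (a : cindex M).
Variable V : cindex M -> M -> 'rV[R]_n.
Hypothesis V_smooth : mx_smooth a (V a).
Implicit Types (p q : M).
Local Notation D := (mx_pd a).
Local Notation Gam := (conn a).

Definition nabla_dir i p : 'rV[R]_n := D i (V a) p + V a p *m Gam i p.

Lemma nabla_entry i k p : nabla V a p i k = nabla_dir i p 0 k.
Proof.
rewrite /nabla_dir entry_add entry_mul mx_pdE mxE; congr (_ + _).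
by apply: eq_bigr => l _; rewrite conn_entry mulrC.
Qed.

Lemma nabla_dir_smooth i : mx_smooth a (nabla_dir i).
Proof.
apply: mx_smoothD; first exact: mx_smooth_pd.
by apply: mx_smoothM => //; exact: conn_smooth.
Qed.

Lemma nabla_smooth : mx_smooth a (nabla V a).
Proof.
move=> i k; apply: smooth_ext (nabla_dir_smooth i 0 k) => q _.
by rewrite nabla_entry.
Qed.

(** The index i of nabla_i V is not differentiated covariantly here; the missing
    corrections cancel in the commutator because the connection is
    torsion-free. *)
Lemma nabla_commutator i j p : dom a p ->
  (D i (nabla_dir j) p + nabla_dir j p *m Gam i p)
  - (D j (nabla_dir i) p + nabla_dir i p *m Gam j p) = V a p *m curv a i j p.
Proof.
move=> ap; have sG u := @conn_smooth _ _ M a u.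
have dG u := mx_smooth_pdiff (sG u) ap.
have dV := mx_smooth_pdiff V_smooth ap.
have E u w : D u (nabla_dir w) p = D u (D w (V a)) p
   + (D u (V a) p *m Gam w p + V a p *m D u (Gam w) p).
  rewrite [LHS](@mx_pdD _ _ _ a _ _ u (D w (V a)) (fun q => V a q *m Gam w q)).
  - by rewrite (mx_pdM u ap dV (dG w)).
  - by apply: mx_smooth_pdiff ap; exact: mx_smooth_pd.
  - by apply: mx_smooth_pdiff ap; exact: mx_smoothM.
rewrite !E (mx_pd_comm i j V_smooth ap) curv_def /nabla_dir; mx_abel.
Qed.

(** Bochner's formula div (nabla V) = d (div V) + Ric V, a trace of
    [nabla_commutator]. *)
Lemma ricci_identity m p : dom a p ->
  div_mx a m (nabla V a) p = pd a m (fun q => \tr (nabla V a q)) p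
    + \sum_k ricci_tensor a p m k * V a p 0 k.
Proof.
move=> ap; apply/eqP; rewrite addrC -subr_eq; apply/eqP.
transitivity (\sum_i (V a p *m curv a i m p) 0 i); last first.
  under eq_bigr => i _ do rewrite entry_mul.
  rewrite exchange_big; apply: eq_bigr => k _; rewrite -mulr_sumr mulrC mxE; congr (_ * _).
  by apply: eq_bigr => i _; rewrite curvE.
under [RHS]eq_bigr => i _ do rewrite -nabla_commutator // 2!entry_add entry_opp entry_add.
rewrite sumrB big_split /= [X in _ = _ - X]big_split /= /div_mx.
under [in LHS]eq_bigr => i _ do rewrite entry_add.
rewrite big_split /= -!addrA; congr (_ + (_ + _)).
- apply: eq_bigr => i _; rewrite !mx_pdE; apply: pd_eq => q; exact: nabla_entry.
- apply: eq_bigr => i _; rewrite !entry_mul; apply: eq_bigr => l _.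
  by rewrite nabla_entry.
- rewrite -opprD; congr (- _); rewrite [LHS]addrC; congr (_ + _).
    rewrite /mxtrace pd_sum => [|i]; last by apply: smooth_pdiff ap; exact: nabla_smooth.
    apply: eq_bigr => i _; rewrite mx_pdE; apply: pd_eq => q; exact: nabla_entry.
  apply: eq_bigr => i _; rewrite !entry_mul; apply: eq_bigr => l _.
  by rewrite nabla_entry.
Qed.

(** For a geodesic field, V(nabla V) = 0 moves the derivative from nabla V to V, and
    nabla V appears twice. *)
Lemma raychaudhuri p : dom a p -> (forall q, dom a q -> V a q *m nabla V a q = 0) ->
  \sum_m V a p 0 m * div_mx a m (nabla V a) p = - \tr (nabla V a p *m nabla V a p).
Proof.
move=> ap geo; set A := nabla V a.
have dA := mx_smooth_pdiff nabla_smooth ap.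
have dV := mx_smooth_pdiff V_smooth ap.
have G1 i : (V a p *m D i A p) 0 i = - (D i (V a) p *m A p) 0 i.
  have : D i (fun q => V a q *m A q) p = 0.
    by rewrite -(mx_pd_cst a i 0 p); apply: mx_pd_ext ap _; exact: geo.
  rewrite mx_pdM // => /(congr1 (fun X : 'rV_n => X 0 i)).
  by rewrite entry_add entry_zero => /eqP; rewrite addrC addr_eq0 => /eqP.
have G2 i : (V a p *m (A p *m Gam i p)) 0 i = 0.
  by rewrite mulmxA geo // mul0mx entry_zero.
rewrite /div_mx.
under eq_bigr => m _ do rewrite mulrBr mulr_sumr.
rewrite sumrB exchange_big /=.
have -> : \sum_i \sum_m V a p 0 m * (D i A p + A p *m Gam i p) m i =
    - \sum_i (D i (V a) p *m A p) 0 i.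
  rewrite -sumrN; apply: eq_bigr => i _.
  by rewrite -(entry_mul (V a p) (D i A p + A p *m Gam i p)) mulmxDr entry_add G2 addr0 G1.
have -> : \sum_m V a p 0 m * \tr (A p *m Gam m p) = \sum_l \sum_i (V a p *m Gam l p) 0 i * A p i l.
  rewrite /mxtrace; under eq_bigr => m _ do rewrite mulr_sumr.
  under eq_bigr => m _ do under eq_bigr => i _ do rewrite entry_mul mulr_sumr.
  rewrite exchange_big /= [RHS]exchange_big /=; apply: eq_bigr => i _.
  rewrite exchange_big /=; apply: eq_bigr => l _; rewrite entry_mul mulr_suml.
  by apply: eq_bigr => m _; rewrite mulrCA mulrC (conn_sym _ _ _ ap).
have -> : \tr (A p *m A p) = \sum_l \sum_i nabla_dir l p 0 i * A p i l.
  rewrite /mxtrace; apply: eq_bigr => l _; rewrite entry_mul; apply: eq_bigr => i _.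
  by rewrite {1}/A nabla_entry.
rewrite -opprD -big_split; congr (- _); apply: eq_bigr => l _ /=.
rewrite entry_mul -big_split; apply: eq_bigr => i _ /=.
by rewrite -mulrDl -entry_add.
Qed.

End RicciIdentity.

(** * Lorentzian linear algebra *)

Section Minkowski.
Variables (R : realType) (n : nat).
Local Notation eta := (Defs.minkowski R n.+1).
Definition minkowski_sign (j : 'I_n.+1) : R := if j == ord0 then -1 else 1.

Lemma minkowskiE i j : eta i j = minkowski_sign i *+ (i == j).
Proof. by rewrite mxE /minkowski_sign -(inj_eq val_inj) /=; case: eqVneq. Qed.

Lemma mul_minkowski m (X : 'M[R]_(m, n.+1)) i j : (X *m eta) i j = X i j * minkowski_sign j.
Proof.
rewrite mxE (bigD1 j) //= big1 => [|k kj]; first by rewrite minkowskiE eqxx addr0.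
by rewrite minkowskiE (negbTE kj) mulr0.
Qed.

Lemma minkowski_sq : eta *m eta = 1%:M.
Proof.
apply/matrixP => i j; rewrite mul_minkowski minkowskiE !mxE /minkowski_sign.
have [->|ij] := eqVneq i j; last by rewrite mul0r.
by case: ifP => _; rewrite ?mulrNN mulr1.
Qed.

Lemma minkowski_null_eq0 (u : 'rV[R]_n.+1) : u *m eta *m u^T = 0 -> u 0 0 = 0 -> u = 0.
Proof.
move=> /matrixP /(_ 0 0); rewrite !mxE => un u0.
have : \sum_j (u 0 j) ^+ 2 = 0.
  rewrite -[RHS]un; apply: eq_bigr => j _; rewrite mul_minkowski mxE /minkowski_sign.
  by case: eqP => [->|_]; rewrite ?u0 ?expr2 ?mulr0 // mulr1.
move=> /eqP; rewrite psumr_eq0 => [/allP u2|j _]; last exact: sqr_ge0.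
apply/rowP => j; rewrite mxE; apply/eqP; rewrite -sqrf_eq0.
by apply: (u2 j); rewrite mem_index_enum.
Qed.

(** The first row and column of X, hence the negative sign of the form, do not
    contribute to the trace, which is a sum of squares. *)
Lemma minkowski_trace_eq0 (X : 'M[R]_n.+1) : X^T = X -> row 0 X = 0 ->
  \tr (X *m eta *m (X *m eta)) = 0 -> X = 0.
Proof.
move=> Xs X0 tr0.
have Xr j : X 0 j = 0 by have /rowP/(_ j) := X0; rewrite !mxE.
have Xsym i j : X i j = X j i by rewrite -[in LHS]Xs mxE.
have XE i j : X i j * minkowski_sign i = X i j.
  by rewrite /minkowski_sign; case: eqP => [->|_]; rewrite ?Xr ?mul0r ?mulr1.
have : \sum_i \sum_j (X i j) ^+ 2 = 0.
  rewrite -[RHS]tr0 /mxtrace; apply: eq_bigr => i _; rewrite mxE.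
  apply: eq_bigr => j _; rewrite !mul_minkowski (Xsym j i) XE.
  by rewrite Xsym XE expr2.
move=> /eqP; rewrite psumr_eq0 => [/allP X2|i _]; last by apply: sumr_ge0 => j _; exact: sqr_ge0.
apply/matrixP => i j; rewrite [RHS]mxE; apply/eqP; rewrite -sqrf_eq0.
have := X2 i; rewrite mem_index_enum => /(_ isT) /=.
rewrite psumr_eq0 => [/allP Xi|k _]; last exact: sqr_ge0.
by apply: (Xi j); rewrite mem_index_enum.
Qed.

End Minkowski.

Lemma form_tr (R : comPzRingType) m (X : 'M[R]_m) (u w : 'rV[R]_m) : X^T = X ->
  (u *m X *m w^T)^T = w *m X *m u^T.
Proof. by move=> Xs; rewrite trmx_mul trmxK trmx_mul Xs mulmxA. Qed.

Section LorentzianForm.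
Variables (R : realType) (n : nat) (G : 'M[R]_n.+1).
Hypothesis G_lor : lorentzian_form G.
Local Notation P := (invmx G).
Local Notation eta := (Defs.minkowski R n.+1).
Implicit Types (u v w : 'rV[R]_n.+1).

Lemma lorentzian_sym : G^T = G. Proof. by case: G_lor. Qed.

Lemma lorentzian_unit : G \in unitmx.
Proof.
have [_ [Q uQ E]] := G_lor.
have : eta \in unitmx by have [] := mulmx1_unit (minkowski_sq R n).
by rewrite -E !unitmx_mul => /andP[/andP[]].
Qed.

(** The time component of a null vector in a pseudo-orthonormal frame is, up to
    sign, the Euclidean norm of its spatial part. *)
Lemma null_frame_eq0 Q v : Q \in unitmx -> Q *m G *m Q^T = eta ->
  v *m G *m v^T = 0 -> (v *m invmx Q) 0 0 = 0 -> v = 0.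
Proof.
move=> uQ E v0 vQ0.
suff : v *m invmx Q = 0 by move=> /(congr1 (mulmx^~ Q)); rewrite mulmxKV // mul0mx.
apply: minkowski_null_eq0 => //.
by rewrite -E trmx_mul !mulmxA mulmxKV // -(mulmxA _ Q^T) -trmx_mul mulVmx // trmx1 mulmx1.
Qed.

(** Subtracting from u the multiple of v with the same time component leaves a null
    vector without time component. *)
Lemma null_orthogonal_collinear u v : v != 0 -> v *m G *m v^T = 0 ->
  u *m G *m u^T = 0 -> u *m G *m v^T = 0 -> exists f, u = f *: v.
Proof.
move=> vn0 vv uu uv; have [Gs [Q uQ E]] := G_lor.
have v0 : (v *m invmx Q) 0 0 != 0.
  by apply: contra vn0 => /eqP /(null_frame_eq0 uQ E vv) ->.
have vu : v *m G *m u^T = 0.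
  by rewrite -(form_tr _ _ Gs) uv trmx0.
exists ((u *m invmx Q) 0 0 / (v *m invmx Q) 0 0); set f := _ / _.
apply/eqP; rewrite -subr_eq0; apply/eqP; apply: (null_frame_eq0 uQ E).
  have -> : (u - f *: v)^T = u^T - f *: v^T by rewrite linearB linearZ.
  rewrite !mulmxBl !mulmxBr -!scalemxAl -!scalemxAr.
  by rewrite uu uv vu vv !scaler0 !subr0.
rewrite mulmxBl -scalemxAl !mxE /f.
set x := \sum_j _; set y := \sum_j _.
have -> : y = (v *m invmx Q) 0 0 by rewrite mxE.
by rewrite mulfVK // -[X in X - _]/x mxE subrr.
Qed.

Variables (v : 'rV[R]_n.+1) (A : 'M[R]_n.+1).
Hypotheses (v_n0 : v != 0) (v_null : v *m G *m v^T = 0)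
  (AG_sym : (A *m G)^T = A *m G) (vA0 : v *m A = 0) (trA2 : \tr (A *m A) = 0).
Local Notation S := (A *m G).
Local Notation l := (v *m G).

(** Choose a timelike w with l(w) = -1 and put s = g(A w, -), c = s(w).  The form
    D = S + l^T s + s^T l + c l^T l, with S = A G, is chosen so that w D = 0;
    every mixed term of tr D^2 contains A v, g(v, v) or s(v), so
    tr D^2 = tr A^2 = 0.  As D lives on the spacelike orthogonal of w, D = 0. *)
Lemma null_operator_form : exists2 al : 'rV[R]_n.+1,
  A *m G = l^T *m al + al^T *m l & al *m v^T = 0.
Proof.
have [Gs [Q uQ E]] := G_lor; have uG := lorentzian_unit.
have lv : l *m v^T = 0 by [].
have vl : v *m l^T = 0 by rewrite trmx_mul Gs mulmxA.
have Sv : S *m v^T = 0.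
  by rewrite -{1}AG_sym -trmx_mul mulmxA vA0 mul0mx trmx0.
have lP : l *m P = v by rewrite mulmxK.
have Ps : P^T = P by rewrite trmx_inv Gs.
have Pl : P *m l^T = v^T by rewrite trmx_mul Gs mulKmx.
have SP : S *m P = A by rewrite mulmxK.
have Al : A *m l^T = 0 by rewrite -SP -mulmxA Pl.
have GP : P = Q^T *m eta *m Q.
  have uE : Q^T *m eta *m Q *m G = 1%:M.
    have uQT : Q^T \in unitmx by rewrite unitmx_tr.
    have H : eta *m (Q *m G *m Q^T) = 1%:M by rewrite E minkowski_sq.
    apply: (can_inj (mulmxK uQT)); rewrite mul1mx -!mulmxA.
    by rewrite (mulmxA Q) H mulmx1.
  by rewrite -[LHS]mul1mx -uE mulmxK.
(* the timelike frame vector, rescaled so that l w = -1; l does not vanish on it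
   because v is null *)
pose e := row 0 Q.
have le0 : (l *m e^T) 0 0 != 0.
  have -> : (l *m e^T) 0 0 = - (v *m invmx Q) 0 0.
    transitivity ((v *m invmx Q *m eta) 0 0).
      rewrite -E !mulmxA mulmxKV // [LHS]mxE [RHS]mxE.
      by apply: eq_bigr => j _; rewrite !mxE.
    by rewrite mul_minkowski /minkowski_sign eqxx mulrN1.
  rewrite oppr_eq0; apply: contra v_n0 => /eqP /(null_frame_eq0 uQ E v_null) ->.
  by [].
pose w := (- ((l *m e^T) 0 0)^-1) *: e.
have lw : l *m w^T = - 1%:M.
  rewrite /w linearZ /= -scalemxAr scaleNr; congr (- _).
  apply/matrixP => i j; rewrite !ord1 [LHS]mxE mulVf //.
  by rewrite mxE eqxx.
have wl : w *m l^T = - 1%:M by rewrite -[w]trmxK -trmx_mul lw linearN /= trmx1.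
have [s sE] : exists s, s = w *m S by eexists.
have [c cE] : exists c, c = s *m w^T by eexists.
have cs : c^T = c by rewrite cE sE form_tr.
have ws : w *m s^T = c by rewrite -cs cE trmx_mul trmxK.
have sv : s *m v^T = 0 by rewrite sE -mulmxA Sv mulmx0.
have vs : v *m s^T = 0 by rewrite -[v]trmxK -trmx_mul sv trmx0.
pose D := S + l^T *m s + s^T *m l + l^T *m c *m l.
have wD : w *m D = 0.
  rewrite /D !mulmxDr -sE !(mulmxA w) wl ws !mulNmx !mul1mx subrr add0r.
  exact: subrr.
have Ds : D^T = D.
  rewrite /D !linearD /= AG_sym !trmx_mul !trmxK Gs cs !mulmxA.
  by rewrite -!addrA; congr (_ + _); rewrite addrCA.
pose t := s *m P.
have tl : t *m l^T = 0 by rewrite /t -mulmxA Pl.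
have tDP : \tr (D *m P *m (D *m P)) = 0.
  have -> : D *m P = A + l^T *m t + s^T *m v + l^T *m c *m v.
    by rewrite /D !mulmxDl SP -!(mulmxA _ l P) lP -(mulmxA _ s P).
  have Z1 (X : 'M[R]_n.+1) : \tr (l^T *m t *m X) = \tr (t *m X *m l^T).
    by rewrite -mulmxA mxtrace_mulC.
  have vX (X : 'M[R]_n.+1) (y : 'cV[R]_n.+1) : y *m v *m (A + l^T *m t + s^T *m v + l^T *m c *m v) = 0.
    by rewrite -mulmxA !(mulmxDr v) vA0 !(mulmxA v) vl vs !mul0mx !addr0 mulmx0.
  rewrite [X in \tr X]mulmxDl (vX A (l^T *m c)) addr0.
  rewrite mulmxDl (vX A s^T) addr0 mulmxDl [LHS]mxtraceD Z1.
  have -> : t *m (A + l^T *m t + s^T *m v + l^T *m c *m v) *m l^T = 0.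
    rewrite -mulmxA !mulmxDl Al -!(mulmxA _ v l^T) -(mulmxA _ t l^T) vl tl.
    by rewrite !mulmx0 !addr0 mulmx0.
  rewrite mxtrace0 addr0 !mulmxDr !mxtraceD trA2 !mulmxA Al !mul0mx mxtrace0.
  by rewrite !addr0 add0r mxtrace_mulC !mulmxA vA0 mul0mx mxtrace0.
have D0 : D = 0.
  have uQT : Q^T \in unitmx by rewrite unitmx_tr.
  suff H : Q *m D *m Q^T = 0.
    have : invmx Q *m (Q *m D *m Q^T) *m invmx Q^T = 0 by rewrite H mulmx0 mul0mx.
    by rewrite -mulmxA mulmxK // mulKmx.
  apply: minkowski_trace_eq0.
  - by rewrite !trmx_mul trmxK Ds mulmxA.
  - have eD : e *m D = 0.
      have /eqP := wD; rewrite /w -scalemxAl scaler_eq0 oppr_eq0 invr_eq0 (negbTE le0) /=.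
      by move/eqP.
    by rewrite row_mul row_mul -/e eD mul0mx.
  - rewrite -[RHS]tDP GP.
    transitivity (\tr (Q *m (D *m (Q^T *m eta *m Q) *m D *m Q^T *m eta))).
      by rewrite !mulmxA.
    by rewrite mxtrace_mulC !mulmxA.
exists (- s - 2^-1 *: (c *m l)); last first.
  by rewrite mulmxBl mulNmx sv oppr0 sub0r -scalemxAl -mulmxA lv mulmx0 scaler0 oppr0.
have -> : S = - (l^T *m s + s^T *m l + l^T *m c *m l).
  by apply/eqP; rewrite -addr_eq0 !addrA; apply/eqP.
have clT : (c *m l)^T = l^T *m c by rewrite -{2}cs -trmx_mul.
have -> : (- s - 2^-1 *: (c *m l))^T = - s^T - 2^-1 *: (l^T *m c).
  by rewrite linearB /= linearN /= linearZ /= clT.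
rewrite mulmxBr mulmxBl mulmxN mulNmx -scalemxAr -scalemxAl (mulmxA _ c l).
have H : l^T *m c *m l = 2^-1 *: (l^T *m c *m l) + 2^-1 *: (l^T *m c *m l).
  by rewrite -scalerDl -[2^-1]mul1r -splitr scale1r.
rewrite {1}H.
move: (2^-1 *: _) (_ *m s) (s^T *m _) => x y z.
by rewrite !opprD !addrA; congr (_ - _); rewrite -!addrA; congr (_ + _); rewrite addrC.
Qed.

Let lP : l *m P = v. Proof. by rewrite mulmxK // lorentzian_unit. Qed.
Let Pl : P *m l^T = v^T.
Proof. by rewrite trmx_mul lorentzian_sym mulKmx // lorentzian_unit. Qed.

Lemma null_operator_trace : \tr A = 0.
Proof.
have uG := lorentzian_unit; have [al E av] := null_operator_form.
have -> : A = (A *m G) *m P by rewrite mulmxK.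
rewrite E mulmxDl mxtraceD -(mulmxA l^T al P) -(mulmxA al^T l P) lP.
rewrite mxtrace_mulC -(mulmxA al) Pl av mxtrace0 add0r.
by rewrite -mxtrace_tr trmx_mul trmxK mxtrace_mulC av mxtrace0.
Qed.

(** A^2 is g(al, al) times the rank one operator X |-> l(X) v. *)
Lemma null_operator_sq : exists al : 'rV[R]_n.+1,
  [/\ A = l^T *m (al *m P) + al^T *m v, al *m v^T = 0 &
   A *m A = l^T *m (al *m P *m al^T) *m v].
Proof.
have uG := lorentzian_unit; have [al E av] := null_operator_form.
have AE : A = l^T *m (al *m P) + al^T *m v.
  have -> : A = (A *m G) *m P by rewrite mulmxK.
  by rewrite E mulmxDl -(mulmxA l^T al P) -(mulmxA al^T l P) lP.
exists al; split => //.
rewrite {1}AE mulmxDl -(mulmxA al^T) vA0 mulmx0 addr0 AE mulmxDr.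
have -> : l^T *m (al *m P) *m (l^T *m (al *m P)) = 0.
  by rewrite -mulmxA (mulmxA (al *m P)) -(mulmxA al) Pl av mul0mx mulmx0.
by rewrite add0r !mulmxA.
Qed.

Lemma null_operator_cube : A *m A *m A = 0.
Proof.
by have [al [_ _ ->]] := null_operator_sq; rewrite -mulmxA vA0 mulmx0.
Qed.

(** If A^2 = 0 then al is null, and it is orthogonal to v, hence a multiple of l. *)
Lemma null_operator_rank1 : A *m A = 0 -> exists f : R, A = f *: (l^T *m v).
Proof.
have uG := lorentzian_unit; have Gs := lorentzian_sym.
have [al [AE av ->]] := null_operator_sq => A20.
have ln0 : l != 0.
  by apply: contra v_n0 => /eqP l0; rewrite -(mulmxK uG v) l0 mul0mx.
have k0 : al *m P *m al^T = 0.
  have [i vi] : exists i, v 0 i != 0.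
    by apply/rV0Pn; rewrite v_n0.
  have [j lj] : exists j, l 0 j != 0.
    by apply/rV0Pn; rewrite ln0.
  have /matrixP/(_ j i) := A20.
  rewrite [RHS]mxE mxE big_ord1 mxE big_ord1 mxE => /eqP.
  rewrite !mulf_eq0 (negbTE vi) (negbTE lj) /= orbF => /eqP k0.
  by apply/matrixP => x y; rewrite !ord1 k0 mxE.
have Ps : P^T = P by rewrite trmx_inv Gs.
have [||f bE] := @null_orthogonal_collinear (al *m P) v v_n0 v_null.
- by rewrite mulmxKV // trmx_mul Ps mulmxA.
- by rewrite mulmxKV.
have aE : al = f *: l by rewrite -(mulmxKV uG al) bE scalemxAl.
have aT : al^T = f *: l^T by rewrite aE linearZ.
by exists (f + f); rewrite AE bE aT -scalemxAl -scalemxAr -scalerDl.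
Qed.

End LorentzianForm.

(** * The weighted Einstein equation in a chart *)

Section Gradient.
Variables (R : realType) (n : nat) (M : spacetime R n) (a : cindex M) (h : M -> R).
Hypothesis h_smooth : smooth_in_chart a h.
Implicit Types (p q : M).
Local Notation D := (mx_pd a).
Local Notation Gam := (conn a).
Local Notation G := (metric a).
Local Notation P := (inv_metric a).
Local Notation v := (grad h a).
Local Notation A := (nabla (grad h) a).

Definition dcoord p : 'rV[R]_n := \row_i pd a i h p.

Lemma dcoord_smooth : mx_smooth a dcoord.
Proof. by move=> k i; apply: smooth_ext (smooth_pd i h_smooth) => q _; rewrite mxE. Qed.

Lemma grad_smooth : mx_smooth a v.
Proof. by apply: mx_smoothM; [exact: dcoord_smooth|exact: inv_metric_smooth]. Qed.

Lemma grad_metric p : dom a p -> v p *m G p = dcoord p.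
Proof. by move=> ap; rewrite -mulmxA inv_metricM // mulmx1. Qed.

Lemma D_dcoord i j p : D i dcoord p 0 j = pd a i (pd a j h) p.
Proof. by rewrite mx_pdE; apply: pd_eq => q; rewrite mxE. Qed.

Lemma grad_dir_metric i p : dom a p ->
  nabla_dir a (grad h) i p *m G p = D i dcoord p - dcoord p *m (Gam i p)^T.
Proof.
move=> ap; have dV := mx_smooth_pdiff grad_smooth ap.
have dG := mx_smooth_pdiff (@metric_smooth _ _ M a) ap.
rewrite -(mx_pd_ext i ap grad_metric) mx_pdM // metric_parallel // -grad_metric //.
rewrite /nabla_dir; mx_abel.
Qed.

Lemma hessian_entry i j p : dom a p ->
  hessian h a p i j = pd a i (pd a j h) p - (dcoord p *m (Gam i p)^T) 0 j.
Proof.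
move=> ap; rewrite -D_dcoord -entry_opp -entry_add -grad_dir_metric //.
rewrite !entry_mul; apply: eq_bigr => k _; by rewrite nabla_entry.
Qed.

Lemma hessian_sym p : dom a p -> (hessian h a p)^T = hessian h a p.
Proof.
move=> ap; apply/matrixP => i j; rewrite entry_tr !hessian_entry // (pd_comm i j h_smooth ap).
congr (_ - _); rewrite !entry_mul; apply: eq_bigr => k _.
by rewrite !entry_tr (conn_sym _ _ _ ap).
Qed.

Lemma laplacianE p : dom a p -> laplacian h a p = \tr (A p).
Proof. by move=> ap; rewrite /laplacian mxtrace_mulC -mulmxA metricMinv // mulmx1. Qed.

Hypothesis v_null : forall q, dom a q -> v q *m G q *m (v q)^T = 0.

(** Half the differential of g(V, V) = 0. *)
Lemma hessian_grad p : dom a p -> hessian h a p *m (v p)^T = 0.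
Proof.
move=> ap; have dV := mx_smooth_pdiff grad_smooth ap.
have dG := mx_smooth_pdiff (@metric_smooth _ _ M a) ap.
apply/matrixP => i j; rewrite !ord1 entry_zero.
have : D i (fun q => v q *m G q *m (v q)^T) p = 0.
  by rewrite -(mx_pd_cst a i 0 p); apply: mx_pd_ext ap _; exact: v_null.
rewrite (mx_pdM i ap (mx_pdiffM dV dG) (mx_pdiff_tr dV)) mx_pdM // mx_pd_tr metric_parallel //.
set x := (nabla_dir a (grad h) i p *m G p *m (v p)^T).
have -> : (D i v p *m G p + v p *m (Gam i p *m G p + G p *m (Gam i p)^T)) *m (v p)^T
  + v p *m G p *m (D i v p)^T = x + x^T.
  rewrite /x /nabla_dir; move: (D i v p) (v p) => du u.
  rewrite !(trmx_prod, trmx_add) trmxK (metric_trmx ap); mx_abel.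
move=> /(congr1 (fun X : 'M[R]_1 => X 0 0)); rewrite entry_add entry_tr entry_zero.
move=> /eqP; rewrite -mulr2n mulrn_eq0 /= => /eqP <-.
rewrite /x !entry_mul; apply: eq_bigr => k _; congr (_ * _).
by rewrite !entry_mul; apply: eq_bigr => l _; rewrite nabla_entry.
Qed.

Lemma grad_geodesic p : dom a p -> v p *m A p = 0.
Proof.
move=> ap; have H : v p *m hessian h a p = 0.
  by rewrite -(hessian_sym ap) -[v p]trmxK -trmx_mul hessian_grad // trmx0.
by rewrite -[A p]mulmx1 -(metricMinv ap) mulmxA mulmxA -(mulmxA (v p)) H mul0mx.
Qed.

Lemma grad_dcoord p : dom a p -> dcoord p *m (v p)^T = 0.
Proof. by move=> ap; rewrite -grad_metric // v_null. Qed.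

Section Einstein.
Variable Lambda : R.
Hypothesis h_pos : forall q, dom a q -> h q != 0.
Hypothesis einstein : forall q, dom a q ->
  h q *: ricci_tensor a q - hessian h a q + (laplacian h a q + Lambda) *: G q = 0.
Local Notation r := (ricci_operator a).

Lemma einstein_mixed p : dom a p ->
  A p = h p *: r p + (\tr (A p) + Lambda) *: 1%:M.
Proof.
move=> ap; have /(congr1 (mulmx^~ (P p))) := einstein ap.
rewrite mul0mx mulmxDl mulmxBl -!scalemxAl metricMinv // -(mulmxA (A p)) metricMinv // mulmx1.
rewrite laplacianE // => /eqP; rewrite addrAC subr_eq0 => /eqP ->.
by [].
Qed.

Let rho p := \tr (r p).

(** The divergence of [einstein_mixed]: Ric V and the derivative of the Laplacian
    occur on both sides of the Ricci identity, leaving h div r = 0. *)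
Lemma scalar_curvature_critical m p : dom a p -> pd a m rho p = 0.
Proof.
move=> ap.
have sr := @ricci_operator_smooth _ _ M a.
have sA := nabla_smooth grad_smooth.
pose f q := \tr (A q) + Lambda.
have sf : smooth_in_chart a f.
  by apply: smoothD; [exact: smooth_trace|exact: smooth_cst].
have s1 : mx_smooth a (fun=> 1%:M : 'M[R]_n) by move=> i j; exact: smooth_cst.
have Dh X g i : mx_smooth a X -> smooth_in_chart a g ->
    D i (fun q => g q *: X q : 'M[R]_n) p = pd a i g p *: X p + g p *: D i X p.
  move=> sX sg; apply/matrixP => k l; rewrite entry_add mx_pdE.
  rewrite (@pd_ext _ _ _ _ _ _ (fun q => g q * X q k l)) // => [|q _]; last by rewrite mxE.
  rewrite pdM //; [|exact: smooth_pdiff|exact: smooth_pdiff].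
  by congr (_ + _); rewrite mxE // mx_pdE.
have divE : div_mx a m A p = h p * div_mx a m r p + \sum_i r p m i * dcoord p 0 i + pd a m f p.
  rewrite (div_mx_ext m ap einstein_mixed) /div_mx.
  have E i : (D i (fun q => h q *: r q + f q *: 1%:M) p + (h p *: r p + f p *: 1%:M) *m Gam i p) m i
     = h p * (D i r p + r p *m Gam i p) m i + r p m i * dcoord p 0 i
       + (pd a i f p * (m == i)%:R + f p * Gam i p m i).
    rewrite mx_pdD; [|by apply: mx_smooth_pdiff ap; exact: mx_smoothZ..].
    rewrite !Dh // mx_pd_cst scaler0 addr0 mulmxDl -!scalemxAl mul1mx.
    by rewrite !entry_add !mxE mx_pdE; ring.
  under eq_bigr => i _ do rewrite E.
  have S1 (g : 'I_n -> R) : \sum_i g i * (m == i)%:R = g m.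
    rewrite (bigD1 m) //= eqxx mulr1 big1 ?addr0 // => i im.
    by rewrite eq_sym (negbTE im) mulr0.
  rewrite !big_split /= (S1 (fun i => pd a i f p)) -!mulr_sumr.
  rewrite mulmxDl -!scalemxAl mul1mx mxtraceD !mxtraceZ.
  have -> : \sum_i Gam i p m i = \tr (Gam m p).
    by apply: eq_bigr => i _; rewrite conn_sym.
  rewrite /f; ring.
have := ricci_identity grad_smooth m ap; rewrite divE.
have -> : \sum_k ricci_tensor a p m k * v p 0 k = \sum_i r p m i * dcoord p 0 i.
  transitivity ((ricci_tensor a p *m (v p)^T) m 0).
    by rewrite entry_mul; apply: eq_bigr => k _; rewrite entry_tr.
  transitivity ((r p *m (dcoord p)^T) m 0).
    by rewrite /ricci_operator -mulmxA /grad trmx_mul inv_metric_sym.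
  by rewrite entry_mul; apply: eq_bigr => k _; rewrite entry_tr.
have -> : pd a m f p = pd a m (fun q => \tr (A q)) p.
  rewrite pdD ?pd_cst ?addr0 //; first exact: smooth_pdiff (smooth_trace sA) ap.
  exact: pdiff_cst.
move=> H; have hd : h p * div_mx a m r p = 0.
  move: H; rewrite addrAC addrC => /eqP; rewrite -subr_eq0 => /eqP H; rewrite -[RHS]H; ring.
rewrite /rho contracted_bianchi //.
by have /eqP := hd; rewrite mulf_eq0 (negbTE (h_pos ap)) /= => /eqP ->; rewrite mulr0.
Qed.

Lemma trace_einstein p : dom a p ->
  \tr (A p) = h p * rho p + n%:R * (\tr (A p) + Lambda).
Proof.
move=> ap; rewrite {1}(einstein_mixed ap) mxtraceD !mxtraceZ mxtrace1; ring.
Qed.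

(** By [trace_einstein] the differential of tr A is a multiple of dh, when n is not
    1, and dh(V) = 0. *)
Lemma grad_critical_trace p : n != 1%N -> dom a p ->
  \sum_m v p 0 m * pd a m (fun q => \tr (A q)) p = 0.
Proof.
move=> n1 ap.
have sr := smooth_trace (@ricci_operator_smooth _ _ M a).
have sA := smooth_trace (nabla_smooth grad_smooth).
have dA := smooth_pdiff sA ap; have dr := smooth_pdiff sr ap; have dhp := smooth_pdiff h_smooth ap.
have cN : pdiff a (fun=> n%:R) p by exact: pdiff_cst.
have cL : pdiff a (fun=> Lambda) p by exact: pdiff_cst.
have dAL := pdiffD dA cL.
have E m : (1 - n%:R) * pd a m (fun q => \tr (A q)) p = rho p * dcoord p 0 m.
  have : pd a m (fun q => \tr (A q)) p = pd a m h p * rho p + n%:R * pd a m (fun q => \tr (A q)) p.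
    rewrite {1}(pd_ext m ap trace_einstein).
    rewrite (pdD m (pdiffM dhp dr) (pdiffM cN dAL)) (pdM m ap dhp dr) (pdM m ap cN dAL).
    by rewrite (pdD m dA cL) !pd_cst (scalar_curvature_critical m ap) mulr0 mul0r add0r !addr0.
  move=> H; rewrite mulrBl mul1r {1}H [in RHS]mxE; ring.
have n0 : (1 - n%:R : R) != 0 by rewrite subr_eq0 eq_sym pnatr_eq1.
apply: (mulfI n0); rewrite mulr0 mulr_sumr.
under eq_bigr => m _ do rewrite mulrCA E mulrCA.
rewrite -mulr_sumr.
have -> : \sum_i v p 0 i * dcoord p 0 i = (dcoord p *m (v p)^T) 0 0.
  by rewrite entry_mul; apply: eq_bigr => k _; rewrite entry_tr mulrC.
by rewrite grad_dcoord // entry_zero mulr0.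
Qed.

Lemma ricci_grad_grad p : dom a p ->
  \sum_m v p 0 m * \sum_k ricci_tensor a p m k * v p 0 k = 0.
Proof.
move=> ap; transitivity ((v p *m ricci_tensor a p *m (v p)^T) 0 0).
  rewrite -mulmxA entry_mul; apply: eq_bigr => m _; congr (_ * _).
  by rewrite entry_mul; apply: eq_bigr => k _; rewrite entry_tr.
apply: (mulfI (h_pos ap)); rewrite mulr0.
have /(congr1 (fun X => v p *m X *m (v p)^T)) := einstein ap.
rewrite mulmxDr mulmxBr !mulmxDl mulmx0 mul0mx mulNmx -!scalemxAr -!scalemxAl v_null // scaler0 addr0.
rewrite -(mulmxA _ (hessian _ _ _)) hessian_grad // mulmx0 subr0.
by move=> /(congr1 (fun X : 'M[R]_1 => X 0 0)); rewrite !mxE.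
Qed.

Lemma trace_sq_eq0 p : n != 1%N -> dom a p -> \tr (A p *m A p) = 0.
Proof.
move=> n1 ap; apply/eqP; rewrite -oppr_eq0 -(raychaudhuri grad_smooth ap grad_geodesic).
under eq_bigr => m _ do rewrite (ricci_identity grad_smooth m ap) mulrDr.
by rewrite big_split /= grad_critical_trace // ricci_grad_grad // addr0.
Qed.

End Einstein.
End Gradient.

(** * Transformation of the gradient and of the Hessian *)

Lemma entry_scale (R : pzRingType) m n (x : R) (A : 'M[R]_(m, n)) i j : (x *: A) i j = x * A i j.
Proof. by rewrite mxE. Qed.

Lemma congr_mx_entry (R : comPzRingType) n (J X : 'M[R]_n) i j :
  (J *m X *m J^T) i j = \sum_c \sum_d J i c * J j d * X c d.
Proof.
rewrite entry_mul exchange_big; apply: eq_bigr => d _; rewrite entry_tr entry_mul mulr_suml.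
by apply: eq_bigr => c _; rewrite mulrAC.
Qed.

Section ChangeOfChart.
Variables (R : realType) (n : nat) (M : spacetime R n) (h : M -> R).
Hypothesis h_smooth : smooth_fun h.
Implicit Types (a b : cindex M) (p q : M).

Lemma dcoord_change a b p : dom a p -> dom b p -> dcoord a h p = dcoord b h p *m (jac a b p)^T.
Proof.
move=> ap bp; apply/rowP => i; rewrite entry_mul mxE.
have [_ ->] := change_of_chart ap bp (h_smooth b).
by apply: eq_bigr => j _; rewrite entry_tr [in RHS]mxE mulrC.
Qed.

Lemma metric_change a b p : dom a p -> dom b p ->
  metric a p = jac a b p *m metric b p *m (jac a b p)^T.
Proof. by have [_] := metric_field M; apply. Qed.

Lemma jac_unit a b p : dom a p -> dom b p -> jac a b p \in unitmx.
Proof.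
move=> ap bp; have := metric_unit ap.
by rewrite (metric_change ap bp) !unitmx_mul => /andP[/andP[]].
Qed.

Lemma grad_change a b p : dom a p -> dom b p -> grad h b p = grad h a p *m jac a b p.
Proof.
move=> ap bp; set J := jac a b p.
have uJ : J^T \in unitmx by rewrite unitmx_tr jac_unit.
apply: (can_inj (mulmxK (metric_unit bp))); apply: (can_inj (mulmxK uJ)).
have -> : grad h a p *m J *m metric b p *m J^T = grad h a p *m metric a p.
  by rewrite (metric_change ap bp) !mulmxA.
by rewrite !grad_metric // -dcoord_change.
Qed.

Lemma grad_vector_field : vector_field (grad h).
Proof.
split; last by move=> a b p; exact: grad_change.
by move=> a i; exact: grad_smooth.
Qed.

(** Twice the contraction of the Christoffel symbols of the first kind with u.  In
    the Hessian it replaces the Christoffel symbols by derivatives of the metric,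
    whose transformation law needs no inverse matrix. *)
Definition christoffel1_row a p (u : 'rV[R]_n) i j : R :=
  (mx_pd a i (metric a) p *m u^T) j 0 + (mx_pd a j (metric a) p *m u^T) i 0
  - \sum_l u 0 l * mx_pd a l (metric a) p i j.

Lemma hessian_christoffel1 a p i j : dom a p -> hessian h a p i j =
  pd a i (pd a j h) p - 2^-1 * christoffel1_row a p (grad h a p) i j.
Proof.
move=> ap; rewrite hessian_entry //; congr (_ - _).
have -> : dcoord a h p *m (conn a i p)^T = grad h a p *m (conn a i p *m metric a p)^T.
  by rewrite trmx_mul metric_trmx // mulmxA grad_metric.
rewrite conn_metric // linearZ /= -scalemxAr mxE; congr (_ * _).
rewrite entry_mul /christoffel1_row !entry_mul -big_split -sumrB; apply: eq_bigr => l _.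
rewrite /= !entry_tr !mx_pdE [christoffel1 _ _ _ _ _]mxE.
by rewrite mulrBr mulrDr; congr (_ + _ - _); rewrite mulrC.
Qed.

Lemma mx_pd_metric_change a b p k : dom a p -> dom b p ->
  let J := jac a b p in let K := mx_pd a k (jac a b) p in
  mx_pd a k (metric a) p = K *m metric b p *m J^T + J *m metric b p *m K^T
    + \sum_c J k c *: (J *m mx_pd b c (metric b) p *m J^T).
Proof.
move=> ap bp J K.
have dJ : mx_pdiff a (jac a b) p by move=> i j; exact: jac_pdiff.
have H i j : pdiff a (fun q => metric b q i j) p /\ forall k, pd a k (fun q => metric b q i j) p =
   \sum_c J k c * pd b c (fun q => metric b q i j) p.
  by apply: change_of_chart => //; exact: metric_smooth.
have dG : mx_pdiff a (metric b) p by move=> i j; have [] := H i j.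
have E : \forall q \near p, metric a q = jac a b q *m metric b q *m (jac a b q)^T.
  have oab : open (dom a `&` dom b) by apply: openI; exact: cdom_open.
  have := open_nbhs_nbhs (conj oab (conj ap bp)); apply: filterS => q [aq bq].
  exact: metric_change.
rewrite (mx_pd_near k ap E).
rewrite (mx_pdM k ap (mx_pdiffM dJ dG) (mx_pdiff_tr dJ)) (mx_pdM k ap dJ dG) mx_pd_tr.
rewrite -/K -/J mulmxDl -!addrA; congr (_ + _); rewrite addrC; congr (_ + _).
have -> : mx_pd a k (metric b) p = \sum_c J k c *: mx_pd b c (metric b) p.
  apply/matrixP => i j; rewrite mx_pdE summxE; have [_ ->] := H i j.
  by apply: eq_bigr => c _; rewrite entry_scale mx_pdE.
rewrite mulmx_sumr mulmx_suml; apply: eq_bigr => c _.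
by rewrite -scalemxAr -scalemxAl.
Qed.

(** The second derivatives of the transition map, applied to dh.  This is the
    non-tensorial part both of the second derivatives of h and of half of
    [christoffel1_row] at the gradient, so it cancels in the Hessian. *)
Definition jac_hess a b p i j : R :=
  \sum_c mx_pd a i (jac a b) p j c * dcoord b h p 0 c.

Lemma second_derivative_change a b p i j : dom a p -> dom b p ->
  pd a i (pd a j h) p =
  (jac a b p *m (\matrix_(c, d) pd b c (pd b d h) p) *m (jac a b p)^T) i j
  + jac_hess a b p i j.
Proof.
move=> ap bp; set J := jac a b p.
have E : \forall q \near p, pd a j h q = \sum_d jac a b q j d * pd b d h q.
  have oab : open (dom a `&` dom b) by apply: openI; exact: cdom_open.
  have := open_nbhs_nbhs (conj oab (conj ap bp)); apply: filterS => q [aq bq].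
  by have [_ ->] := change_of_chart aq bq (h_smooth b).
have H d := change_of_chart ap bp (smooth_pd d (h_smooth b)).
have dd d : pdiff a (pd b d h) p by have [] := H d.
have dJ d : pdiff a (fun q => jac a b q j d) p by exact: jac_pdiff.
rewrite (pd_near i ap E) pd_sum => [|d]; last exact: pdiffM (dJ d) (dd d).
rewrite congr_mx_entry exchange_big /jac_hess -big_split; apply: eq_bigr => d _ /=.
rewrite (pdM i ap (dJ d) (dd d)) mx_pdE [dcoord b h p 0 d]mxE addrC; congr (_ + _).
have [_ ->] := H d; rewrite mulr_sumr; apply: eq_bigr => c _.
by rewrite [(\matrix_(_, _) _) c d]mxE mulrCA mulrA.
Qed.

Lemma christoffel1_row_change a b p i j : dom a p -> dom b p ->
  christoffel1_row a p (grad h a p) i j =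
  (jac a b p *m (\matrix_(c, d) christoffel1_row b p (grad h b p) c d) *m (jac a b p)^T) i j
  + 2 * jac_hess a b p i j.
Proof.
move=> ap bp; set J := jac a b p; set u := grad h a p; set w := grad h b p.
pose K k := mx_pd a k (jac a b) p; pose B c := mx_pd b c (metric b) p.
have wE : w = u *m J by exact: grad_change.
have Ksym k l c : K k l c = K l k c by rewrite /K !mx_pdE jac_symm.
have dhb : metric b p *m w^T = (dcoord b h p)^T.
  by rewrite -grad_metric // [RHS]trmx_mul metric_trmx.
have DG k := mx_pd_metric_change k ap bp.
(* comes from the derivative of the factor J on the other side; it occurs in all
   three terms and cancels *)
pose X k := u *m K k *m metric b p *m J^T.
have T1 k l : (mx_pd a k (metric a) p *m u^T) l 0 =
   jac_hess a b p k l + X k 0 l + \sum_c \sum_d J k c * J l d * (B c *m w^T) d 0.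
  rewrite DG -/J -/(K k) !mulmxDl entry_add entry_add; congr (_ + _ + _).
  - rewrite -mulmxA -trmx_mul -wE -mulmxA dhb entry_mul.
    by apply: eq_bigr => c _; rewrite entry_tr.
  - rewrite -[X k]trmxK entry_tr /X !trmx_prod trmxK metric_trmx //.
    by rewrite !mulmxA.
  - rewrite mulmx_suml summxE; apply: eq_bigr => c _.
    rewrite -scalemxAl entry_scale -mulmxA -trmx_mul -wE -mulmxA entry_mul mulr_sumr.
    by apply: eq_bigr => d _; rewrite mulrA.
have T3 : \sum_l u 0 l * mx_pd a l (metric a) p i j = X i 0 j + X j 0 i
   + \sum_c \sum_d J i c * J j d * \sum_e w 0 e * B e c d.
  under eq_bigr => l _ do rewrite DG -/J -/(K l) !entry_add !mulrDr.
  rewrite !big_split /=.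
  have U k l : \sum_m u 0 m * (K m *m metric b p *m J^T) k l = X k 0 l.
    rewrite /X -(mulmxA (u *m K k)) entry_mul.
    under [LHS]eq_bigr => m _ do rewrite -mulmxA entry_mul mulr_sumr.
    rewrite exchange_big; apply: eq_bigr => c _ /=; rewrite (entry_mul u (K k)) mulr_suml.
    by apply: eq_bigr => m _; rewrite Ksym mulrA.
  rewrite U; congr (_ + _ + _).
    rewrite -U; apply: eq_bigr => m _; congr (_ * _).
    by rewrite -entry_tr !trmx_prod trmxK metric_trmx // mulmxA.
  under eq_bigr => l _ do rewrite summxE mulr_sumr.
  rewrite exchange_big /=.
  under eq_bigr => e _ do under eq_bigr => l _ do rewrite entry_scale mulrA congr_mx_entry.
  under eq_bigr => e _ do rewrite -mulr_suml.
  have wl e : \sum_l u 0 l * J l e = w 0 e by rewrite wE entry_mul.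
  under eq_bigr => e _ do rewrite wl mulr_sumr.
  rewrite exchange_big; apply: eq_bigr => c _.
  under eq_bigr => e _ do rewrite mulr_sumr.
  rewrite exchange_big; apply: eq_bigr => d _ /=; rewrite mulr_sumr.
  by apply: eq_bigr => e _; rewrite mulrCA.
rewrite /christoffel1_row T1 T1 T3.
have -> : jac_hess a b p j i = jac_hess a b p i j.
  by apply: eq_bigr => c _; rewrite -/(K j) Ksym.
have -> : (J *m (\matrix_(c, d) ((B c *m w^T) d 0 + (B d *m w^T) c 0
   - \sum_l w 0 l * B l c d)) *m J^T) i j =
   \sum_c \sum_d J i c * J j d * (B c *m w^T) d 0
   + \sum_c \sum_d J j c * J i d * (B c *m w^T) d 0
   - \sum_c \sum_d J i c * J j d * \sum_e w 0 e * B e c d.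
  rewrite congr_mx_entry [X in _ + X - _]exchange_big -big_split -sumrB.
  apply: eq_bigr => c _ /=; rewrite -big_split -sumrB; apply: eq_bigr => d _ /=.
  by rewrite [in LHS]mxE; ring.
ring.
Qed.

Lemma hessian_change a b p : dom a p -> dom b p ->
  hessian h a p = jac a b p *m hessian h b p *m (jac a b p)^T.
Proof.
move=> ap bp; apply/matrixP => i j.
rewrite hessian_christoffel1 // (second_derivative_change i j ap bp).
rewrite (christoffel1_row_change i j ap bp) mulrDr mulrA mulVf ?mul1r; last by [].
rewrite !congr_mx_entry opprD addrACA subrr addr0 mulr_sumr -sumrB.
apply: eq_bigr => c _; rewrite mulr_sumr -sumrB; apply: eq_bigr => d _.
rewrite 2![(\matrix_(_, _) _) c d]mxE hessian_christoffel1 //.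
by rewrite [RHS]mulrBr; congr (_ - _); exact: mulrCA.
Qed.

Lemma nabla_grad_change a b p : dom a p -> dom b p ->
  nabla (grad h) a p *m jac a b p = jac a b p *m nabla (grad h) b p.
Proof.
move=> ap bp; have := hessian_change ap bp; rewrite /hessian (metric_change ap bp).
have uJ : (jac a b p)^T \in unitmx by rewrite unitmx_tr jac_unit.
rewrite !mulmxA => /(can_inj (mulmxK uJ)) /(can_inj (mulmxK (metric_unit bp))).
by [].
Qed.

End ChangeOfChart.

(** * Isotropic solutions *)

Lemma null_symmetric_operator (R : realType) n (G A : 'M[R]_n) (v : 'rV[R]_n) :
  lorentzian_form G -> v != 0 -> v *m G *m v^T = 0 -> (A *m G)^T = A *m G ->
  v *m A = 0 -> \tr (A *m A) = 0 ->
  [/\ \tr A = 0, A *m A *m A = 0 &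
    A *m A = 0 -> exists f : R, A = f *: ((v *m G)^T *m v)].
Proof.
case: n G A v => [|n] G A v Gl v0 vv As vA A2; first by rewrite [v]thinmx0 eqxx in v0.
split; [exact: null_operator_trace vv _ _ _|exact: null_operator_cube vv _ _ _|].
exact: null_operator_rank1.
Qed.

Lemma mulmx_row_inj (R : realType) m n (x y : 'cV[R]_m) (v : 'rV[R]_n) :
  v != 0 -> x *m v = y *m v -> x = y.
Proof.
move=> /rV0Pn [k vk] /matrixP xy; apply/colP => i.
have := xy i k; rewrite !mxE !big_ord1 !(ord1 0); exact: mulIf.
Qed.

Section IsotropicSolution.
Variables (R : realType) (n : nat) (M : spacetime R n) (h : M -> R) (Lambda : R).
Hypotheses (n_ge3 : (3 <= n)%N) (h_smooth : smooth_fun h) (h_pos : forall p : M, 0 < h p)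
  (h_einstein : vacuum_weighted_einstein h Lambda) (h_isotropic : lightlike (grad h)).
Implicit Types (a b : cindex M) (p q : M).

Local Notation v := (grad h).
Local Notation A := (nabla (grad h)).

Let v_null a q : dom a q -> v a q *m metric a q *m (v a q)^T = 0.
Proof. by move=> aq; case: (h_isotropic aq). Qed.

Let v_neq0 a q : dom a q -> v a q != 0.
Proof. by move=> aq; case: (h_isotropic aq). Qed.

Let h_neq0 a q : dom a q -> h q != 0.
Proof. by move=> _; rewrite gt_eqF. Qed.

Lemma nabla_trace_sq a p : dom a p -> \tr (A a p *m A a p) = 0.
Proof.
move=> ap; apply: (trace_sq_eq0 (h_smooth a) _ _ (h_einstein (a := a))) => //.
- exact: v_null.
- exact: h_neq0.
- by case: n n_ge3 => [|[]].
Qed.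

Lemma nabla_grad_null a p : dom a p ->
  [/\ \tr (A a p) = 0, A a p *m A a p *m A a p = 0 &
    A a p *m A a p = 0 -> exists f : R, A a p = f *: ((v a p *m metric a p)^T *m v a p)].
Proof.
move=> ap; apply: null_symmetric_operator.
- exact: metric_lorentzian.
- exact: v_neq0.
- exact: v_null.
- exact: hessian_sym.
- by apply: grad_geodesic => //; exact: v_null.
- exact: nabla_trace_sq.
Qed.

(** The trace of the field equation is h tau = - n Lambda; differentiate it where
    tau is critical and dh <> 0. *)
Lemma cosmological_constant_eq0 a p : dom a p -> Lambda = 0.
Proof.
move=> ap.
pose rho q := \tr (ricci_operator a q).
have E q : dom a q -> h q * rho q = - (n%:R * Lambda).
  move=> aq; have := trace_einstein (h_einstein (a := a)) aq.
  have [-> _ _] := nabla_grad_null aq.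
  by rewrite add0r => /esym /eqP; rewrite addr_eq0 => /eqP.
have /rV0Pn [m dm] : dcoord a h p != 0.
  apply: contra (v_neq0 ap) => /eqP H.
  by rewrite -(mulmxK (metric_unit ap) (v a p)) grad_metric // H mul0mx.
have rho0 : rho p = 0.
  have sr := smooth_trace (@ricci_operator_smooth _ _ M a).
  have : pd a m (fun q => h q * rho q) p = 0 by rewrite (pd_ext m ap E) pd_cst.
  rewrite (pdM m ap (smooth_pdiff (h_smooth a) ap) (smooth_pdiff sr ap)).
  rewrite (scalar_curvature_critical (h_smooth a) (h_neq0 (a := a)) (h_einstein (a := a)) m ap).
  rewrite mulr0 addr0 => /eqP; rewrite mulf_eq0 => /orP[|/eqP //].
  by move: dm; rewrite mxE => /negbTE ->.
have := E p ap; rewrite rho0 mulr0 => /esym /eqP; rewrite oppr_eq0 mulf_eq0 pnatr_eq0.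
by case: n n_ge3 => // k _ /= /eqP.
Qed.

Lemma nabla_grad_ricci a p : dom a p -> A a p = h p *: ricci_operator a p.
Proof.
move=> ap; have [tA _ _] := nabla_grad_null ap.
rewrite {1}(einstein_mixed (h_einstein (a := a)) ap) tA.
by rewrite (cosmological_constant_eq0 ap) addr0 scale0r addr0.
Qed.

Lemma ricci_operator_cube a p : dom a p -> ricci_operator a p ^+ 3 = 0.
Proof.
move=> ap; have [_ A3 _] := nabla_grad_null ap; move: A3.
rewrite nabla_grad_ricci // -!(scalemxAl, scalemxAr) !scalerA => /eqP.
rewrite scaler_eq0 !mulf_eq0 (negbTE (h_neq0 ap)) /= => /eqP H.
by rewrite !exprS expr0 mulr1 mulrA; exact: H.
Qed.

(** If A = w^T V, then A V^T = |V|^2 w^T for the Euclidean norm |V| of the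
    components of V in the chart.  This norm depends on the chart, but w does not
    and the formula shows that w is smooth. *)
Definition recurrence_form a p : 'rV[R]_n :=
  ((v a p *m (v a p)^T) 0 0)^-1 *: (A a p *m (v a p)^T)^T.

Let vvT_neq0 a p : dom a p -> (v a p *m (v a p)^T) 0 0 != 0.
Proof.
move=> ap; rewrite entry_mul psumr_eq0 => [|i _]; last by rewrite entry_tr -expr2 sqr_ge0.
apply: contra (v_neq0 ap) => /allP H; apply/eqP/rowP => i; rewrite entry_zero.
have := H i; rewrite mem_index_enum => /(_ isT); rewrite entry_tr mulf_eq0 orbb => /= /eqP //.
Qed.

Lemma recurrence_formE a p : dom a p -> A a p *m A a p = 0 ->
  A a p = (recurrence_form a p)^T *m v a p.
Proof.
move=> ap A2; have [_ _ /(_ A2) [f Af]] := nabla_grad_null ap.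
have vv := vvT_neq0 ap; move: vv Af; rewrite /recurrence_form.
move: (A a p) (v a p) => B u uu ->.
move: (u *m metric a p)^T => l.
have -> : f *: (l *m u) *m u^T = (f * (u *m u^T) 0 0) *: l.
  by rewrite -scalemxAl -mulmxA [u *m u^T]mx11_scalar mul_mx_scalar scalerA !mxE.
by rewrite [X in _ = X *m u]linearZ /= trmxK -!scalemxAl scalerA mulrCA mulVf // mulr1.
Qed.

(** A row of the form w_i V determines w_i, so the law of w follows from those of A
    and V. *)
Lemma recurrence_one_form : (forall a p, dom a p -> A a p *m A a p = 0) ->
  one_form recurrence_form.
Proof.
move=> A2; split => [a i|a b p ap bp].
  have sv := grad_smooth (h_smooth a).
  have sw : mx_smooth a (recurrence_form a).
    apply: mx_smoothZ.
      apply: smoothV; first exact: vvT_neq0.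
      by apply: mx_smoothM => //; exact: mx_smooth_tr.
    apply: mx_smooth_tr; apply: mx_smoothM; last exact: mx_smooth_tr.
    exact: nabla_smooth.
  exact: sw.
have := nabla_grad_change h_smooth ap bp.
rewrite (recurrence_formE ap (A2 a p ap)) (recurrence_formE bp (A2 b p bp)).
rewrite -mulmxA -grad_change // mulmxA => /(mulmx_row_inj (v_neq0 bp)) /(congr1 trmx).
by rewrite trmxK trmx_mul trmxK.
Qed.

Lemma square_zero_brinkmann : (forall a p, dom a p -> A a p *m A a p = 0) ->
  brinkmann_wave M.
Proof.
move=> A2; exists (grad h); split => //; first exact: grad_vector_field.
exists recurrence_form; first exact: recurrence_one_form.
move=> a p X ap; rewrite {1}(recurrence_formE ap (A2 a p ap)) mulmxA.
rewrite [X *m _]mx11_scalar mul_scalar_mx; congr (_ *: _).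
by rewrite entry_mul; apply: eq_bigr => i _; rewrite entry_tr mulrC.
Qed.

Lemma isotropic_kundt : kundt_spacetime M.
Proof.
exists (grad h); split => //; first exact: grad_vector_field.
  by move=> a p ap; apply: grad_geodesic => //; exact: v_null.
move=> a p ap; have [tA _ _] := nabla_grad_null ap.
have Hs := hessian_sym (h_smooth a) ap.
have low i j : nabla_low (grad h) a p i j = nabla_low (grad h) a p j i.
  by have /matrixP/(_ j i) := Hs; rewrite entry_tr.
have ex0 : expansion (grad h) a p = 0.
  by rewrite /expansion -[X in _ * X]/(\tr (A a p)) tA mulr0.
split => //.
  have half (x : R) : 2^-1 * (x + x) = x by field.
  rewrite /shear_sq ex0 expr2 !mulr0 subr0.
  rewrite -[RHS](nabla_trace_sq ap).
  transitivity (\tr (nabla_up (grad h) a p *m nabla_low (grad h) a p)).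
    apply: eq_bigr => i _; rewrite entry_mul; apply: eq_bigr => j _.
    by rewrite (low j i) half.
  rewrite /nabla_up /nabla_low -mulmxA mxtrace_mulC -!mulmxA.
  by rewrite metricMinv // mulmx1.
rewrite /twist_sq big1 // => i _; rewrite big1 // => j _.
by rewrite low subrr !mulr0.
Qed.

End IsotropicSolution.

Theorem theorem1p3 (R : realType) (n : nat) (n_ge3 : (3 <= n)%N)
    (M : spacetime R n) (h : M -> R) (Lambda : R)
    (h_smooth : smooth_fun h)
    (h_pos : forall p : M, 0 < h p)
    (h_nonconstant : forall U : set M, open U -> U !=set0 ->
       ~ exists c : R, forall p : M, U p -> h p = c)
    (h_einstein : vacuum_weighted_einstein h Lambda)
    (h_isotropic : lightlike (grad h)) :
  (ricci_flat M /\
   forall (a : cindex M) (p : M), dom a p -> hessian h a p = 0) \/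
  (ricci_step_nilpotent M 2 /\ brinkmann_wave M) \/
  (ricci_step_nilpotent M 3 /\ kundt_spacetime M).
Proof.
have AE a p (ap : dom a p) :=
  nabla_grad_ricci n_ge3 h_smooth h_pos h_einstein h_isotropic ap.
have [r0|r0] := pselect (forall (a : cindex M) (p : M), dom a p -> ricci_operator a p = 0).
  left; split => a p ap.
    have /(congr1 (mulmx^~ (metric a p))) := r0 a p ap.
    by rewrite mul0mx /ricci_operator -mulmxA inv_metricM // mulmx1.
  by rewrite /hessian AE // r0 // scaler0 mul0mx.
right; have [r2|r2] := pselect (forall (a : cindex M) (p : M), dom a p -> ricci_operator a p ^+ 2 = 0).
  left; split; last first.
    apply: (square_zero_brinkmann n_ge3 h_smooth h_pos h_einstein h_isotropic) => a p ap.
    by rewrite AE // -scalemxAl -scalemxAr mulmxE -expr2 r2 // !scaler0.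
  split => //; apply: contrapT => H; apply: r0 => a p ap; apply: contrapT => /eqP H1.
  by apply: H; exists a, p; rewrite expr1.
right; split; last exact: isotropic_kundt n_ge3 h_smooth h_pos h_einstein h_isotropic.
split; first exact: ricci_operator_cube n_ge3 h_smooth h_pos h_einstein h_isotropic.
apply: contrapT => H; apply: r2 => a p ap; apply: contrapT => /eqP H1.
by apply: H; exists a, p.
Qed.
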